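(* Let $E$ be a $d$-dimensional fractal cube. If $\dim_H E=\dim_{tH}E$, then $E$ has no trivial point.
   Context: A $d$-dimensional fractal cube is a set $E=E(n,\mathcal{D})\subset\mathbb{R}^d$ given by an integer $n\ge 2$ and a digit set $\mathcal{D}=\{d_1,\dots,d_N\}\subset\{0,1,\dots,n-1\}^d$: it is the unique non-empty compact set satisfying $E=\frac1n(E+\mathcal{D})$, i.e. the attractor of the iterated function system $\{\varphi_j(z)=\frac1n(z+d_j)\}_{j=1}^N$. A point $x\in E$ is a trivial point of $E$ if $\{x\}$ is a connected component of $E$. $\dim_H$ denotes the Hausdorff dimension. The topological Hausdorff dimension of a metric space $X$ is $$\dim_{tH}X=\inf_{\mathcal{U}\text{ is a basis of }X}\Bigl(1+\sup_{U\in\mathcal{U}}\dim_H\partial U\Bigr),$$ where $\mathcal{U}$ ranges over the bases of the topology of $X$ and $\dim_H\partial U$ is the Hausdorff dimension of the boundary of $U$, with the convention that $\dim_{tH}\emptyset=\dim_H\emptyset=-1$.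
   Formalization: The formal statement assumes the digit set has at least two elements (N ≥ 2); for N = 1 the fractal cube is a single point with dim_H E = dim_tH E = 0 and that point is trivial, so the claim as written fails there. *)

(* Defs.v *)
From HB Require Import structures.
From mathcomp Require Import all_boot all_order all_algebra.
From mathcomp Require Import all_classical all_reals all_analysis.

Set Implicit Arguments.
Unset Strict Implicit.
Unset Printing Implicit Defensive.

Import Order.TTheory GRing.Theory Num.Theory.
Import numFieldNormedType.Exports.

Local Open Scope classical_set_scope.
Local Open Scope ring_scope.

Section hausdorff_dimension.
Context {R : realType} {T : Type} (dist : T -> T -> R).
Implicit Types (A : set T) (s delta : R).
Local Open Scope ereal_scope.

Definition diameter A : \bar R :=
  ereal_sup [set (dist p.1 p.2)%:E | p in A `*` A].

(* diam(A)^s with the usual conventions: the empty set contributes 0 for every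
   s, and 0^0 = 1 (so that H^0 is the counting measure). *)
Definition diameter_pow s A : \bar R :=
  if A == set0 then 0 else poweR (diameter A) s.

Definition hausdorff_premeasure s delta A : \bar R :=
  ereal_inf [set \sum_(0 <= i <oo) diameter_pow s (F i) | F in
    [set F : (set T)^nat | A `<=` \bigcup_i F i /\
                           forall i, diameter (F i) <= delta%:E]].

(* The premeasure is nonincreasing in delta, so its limit as delta -> 0+ is
   its supremum over delta > 0. *)
Definition hausdorff_measure s A : \bar R :=
  ereal_sup [set hausdorff_premeasure s delta A | delta in
    [set delta : R | (0 < delta)%R]].

Definition hausdorff_dim A : \bar R :=
  if A == set0 then (-1)%:E
  else ereal_inf [set s%:E | s in
         [set s : R | (0 <= s)%R /\ hausdorff_measure s A = 0]].

End hausdorff_dimension.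

Definition boundary {X : topologicalType} (U : set X) : set X :=
  closure U `\` U°.

(* The metric space is the type X; dist is meant to be a metric inducing the
   topology of X. *)
Definition topological_hausdorff_dim {R : realType} {X : topologicalType}
    (dist : X -> X -> R) : \bar R :=
  if [set: X] == set0 then (-1)%:E
  else ereal_inf [set (1%:E + ereal_sup [set hausdorff_dim dist (boundary U) |
                                         U in B])%E
                 | B in [set B : set (set X) | basis B]].

Section euclidean_space.
Context {R : realType} {d : nat}.
Implicit Types (x y : 'rV[R]_d) (E : set 'rV[R]_d).

(* The library norm on 'rV[R]_d is the sup norm; it induces the same topology
   as this distance. *)
Definition euclidean_dist x y : R :=
  Num.sqrt (\sum_(i < d) (x 0 i - y 0 i) ^+ 2).

Definition dim_H E : \bar R := hausdorff_dim euclidean_dist E.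

(* E is seen as a metric space on its own: set_type E carries the topology
   induced by 'rV[R]_d, so bases and boundaries are relative to E. *)
Definition dim_tH E : \bar R :=
  topological_hausdorff_dim
    (fun x y : set_type E => euclidean_dist (set_val x) (set_val y)).

Definition digit_vector {n : nat} (a : 'rV['I_n]_d) : 'rV[R]_d :=
  \row_(i < d) (a 0 i : nat)%:R.

Definition is_fractal_cube (n : nat) (D : {set 'rV['I_n]_d}) E : Prop :=
  [/\ E !=set0, compact E
    & E = [set n%:R^-1 *: (z + digit_vector a) | z in E & a in [set` D]]].

Definition trivial_point E x : Prop :=
  E x /\ connected_component E x = [set x].

End euclidean_space.

(* Main.v *)
Require Import Defs.
From mathcomp Require Import all_boot all_order all_algebra.
From mathcomp Require Import all_classical all_reals all_analysis.
From mathcomp Require Import zify ring lra.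

(* Let E have N digits in base n. Counting cells in covers gives
   dim_H E >= log_n N, so it suffices to find a basis of E whose boundaries have
   dimension < log_n N - 1.
   A trivial point has clopen neighbourhoods of arbitrarily small diameter, that
   is, some level-k cells form a cluster which no other cell touches and which
   does not reach opposite faces of the unit cube. Minimising the number of
   touched faces makes it an island: a cluster inside the open cube. After
   replacing n by n^k, the island is a set I of digits, and its copy in any cell
   is isolated from the rest of E.
   In each direction i some digit j is the i-th coordinate of m <= (N - |I|) / n
   digits outside I. Cut E along a hyperplane whose expansion ends in j j j ...,
   moving every island met on the way entirely to one side. The cut leaves only
   a set covered by C m^p cells of size n^-p for all p, of dimension at most
   log_n m < log_n N - 1 (and empty if m = 0). Intersections of such half-spaces
   form the basis. *)

Set Implicit Arguments.
Unset Strict Implicit.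
Unset Printing Implicit Defensive.

Import Order.TTheory GRing.Theory Num.Theory.
Import numFieldNormedType.Exports.

(** * Words and islands *)

Lemma div_mod_unique M q r q' r' : r < M -> r' < M ->
  q * M + r = q' * M + r' -> q = q' /\ r = r'.
Proof.
move=> rM r'M e; have M0 : 0 < M by lia.
have: (q * M + r) %/ M = (q' * M + r') %/ M by rewrite e.
by rewrite !divnMDl // !divn_small // !addn0 => qq'; split; lia.
Qed.

(** Lets adjacency of concatenated words be read block by block: two such numbers share their
    leading block unless they straddle a block boundary, where the trailing blocks are extreme. *)
Lemma near_blocks M q r q' r' : r < M -> r' < M ->
  q * M + r <= (q' * M + r').+1 -> q' * M + r' <= (q * M + r).+1 ->
  [\/ [/\ q = q', r <= r'.+1 & r' <= r.+1], [/\ q = q'.+1, r = 0 & r' = M.-1] |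
      [/\ q' = q.+1, r = M.-1 & r' = 0]].
Proof.
move=> rM r'M h1 h2; have [qq'|qq'|qq'] := ltngtP q q'; last first.
- by apply: Or31; subst q'; split; lia.
- have e : q = q'.+1.
    apply/eqP; rewrite eqn_leq qq' andbT leqNgt; apply/negP => lt.
    have := leq_mul lt (leqnn M); nia.
  by apply: Or32; subst q; rewrite mulSn in h1; split; lia.
- have e : q' = q.+1.
    apply/eqP; rewrite eqn_leq qq' andbT leqNgt; apply/negP => lt.
    have := leq_mul lt (leqnn M); nia.
  by apply: Or33; subst q'; rewrite mulSn in h2; split; lia.
Qed.

Lemma last_block M M' x r : 0 < M -> 0 < M' -> r < M -> x * M + r = (M' * M).-1 ->
  x = M'.-1 /\ r = M.-1.
Proof.
move=> M0 M'0 rM e; have: x * M + r = M'.-1 * M + M.-1.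
  by rewrite e -{1}(prednK M'0) mulSn; lia.
by case/div_mod_unique => //; lia.
Qed.

Lemma first_block M x r : 0 < M -> x * M + r = 0 -> x = 0 /\ r = 0.
Proof. by nia. Qed.

Section words.
Variable d : nat.
Implicit Types (u v w g : {ffun 'I_d -> nat}) (G : seq {ffun 'I_d -> nat}).

(** Concatenation of expansions in each coordinate: [u] holds the leading digits and [w], meant to
    be below [M], the trailing block. *)
Definition vec_app M u w : {ffun 'I_d -> nat} := [ffun i => u i * M + w i].

Lemma vec_appA M M' u v w :
  vec_app M' (vec_app M u v) w = vec_app (M * M') u (vec_app M' v w).
Proof. by apply/ffunP => i; rewrite !ffunE; lia. Qed.

Lemma vec_app_inj M u w u' w' : (forall i, w i < M) -> (forall i, w' i < M) ->
  vec_app M u w = vec_app M u' w' -> u = u' /\ w = w'.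
Proof.
move=> wM w'M e; have H i : u i = u' i /\ w i = w' i.
  apply: (div_mod_unique (wM i) (w'M i)).
  by move/ffunP/(_ i): e; rewrite !ffunE.
by split; apply/ffunP => i; case: (H i).
Qed.

(* The cells of level [k] of a fractal cube are indexed by these vectors. *)
Fixpoint words n G k : seq {ffun 'I_d -> nat} :=
  if k is k'.+1 then [seq vec_app n u g | u <- words n G k', g <- G]
  else [:: [ffun=> 0]].

Definition digits n G := forall g, g \in G -> forall i, g i < n.

Lemma words1 n G : words n G 1 =i G.
Proof.
move=> v; apply/allpairsP/idP => [[[u g] /= [+ Gg ->]]|Gv].
  rewrite inE => /eqP ->; rewrite (_ : vec_app _ _ _ = g) //.
  by apply/ffunP => i; rewrite !ffunE.
exists ([ffun=> 0], v); split; rewrite ?inE //.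
by apply/ffunP => i; rewrite !ffunE.
Qed.

Lemma words_addP n G j k v :
  v \in words n G (j + k) <->
  exists u w, [/\ u \in words n G j, w \in words n G k & v = vec_app (n ^ k) u w].
Proof.
elim: k v => [|k IH] v.
  rewrite addn0; split=> [vj|[u [w [uj + ->]]]].
    exists v, [ffun=> 0]; split; rewrite ?inE //.
    by apply/ffunP => i; rewrite !ffunE muln1 addn0.
  rewrite inE => /eqP ->; rewrite (_ : vec_app _ _ _ = u) //.
  by apply/ffunP => i; rewrite !ffunE muln1 addn0.
rewrite addnS /=; split=> [/allpairsP[[v' g] /= [/IH[u [w [uj wk ->]]] Gg ->]]|].
  exists u, (vec_app n w g); rewrite vec_appA -expnSr; split => //.
  by apply/allpairsP; exists (w, g).
move=> [u [_ [uj /allpairsP[[w g] /= [wk Gg ->]] ->]]].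
apply/allpairsP; exists (vec_app (n ^ k) u w, g); split => //=.
  by apply/IH; exists u, w.
by rewrite vec_appA -expnSr.
Qed.

Lemma words_lt n G k v i : digits n G -> v \in words n G k -> v i < n ^ k.
Proof.
move=> Gn; elim: k v => [|k IH] v /=; first by rewrite inE => /eqP ->; rewrite ffunE.
move=> /allpairsP[[u g] /= [/IH uk /Gn /(_ i) gn ->]]; rewrite ffunE expnS.
have := leq_mul uk (leqnn n); nia.
Qed.

Lemma words_uniq n G k : digits n G -> uniq G -> uniq (words n G k).
Proof.
move=> Gn uG; elim: k => //= k IH; apply: allpairs_uniq => //.
move=> [u g] [u' g'] /allpairsP[[a b] /= [_ Gb [-> ->]]].
move=> /allpairsP[[a' b'] /= [_ Gb' [-> ->]]] /=.
by case/(vec_app_inj (Gn _ Gb) (Gn _ Gb')) => -> ->.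
Qed.

Lemma size_words n G k : size (words n G k) = size G ^ k.
Proof. by elim: k => //= k IH; rewrite size_allpairs IH expnSr. Qed.

Lemma words_const n G k i v w :
  (forall g h, g \in G -> h \in G -> g i = h i) ->
  v \in words n G k -> w \in words n G k -> v i = w i.
Proof.
move=> Gi; elim: k v w => [|k IH] v w /=; first by rewrite !inE => /eqP -> /eqP ->.
move=> /allpairsP[[u g] /= [uk Gg ->]] /allpairsP[[u' g'] /= [uk' Gg' ->]].
by rewrite !ffunE (IH _ _ uk uk') (Gi _ _ Gg Gg').
Qed.

End words.

(** * Islands and how to move them off the faces of the cube *)

Section islands.
Variables (d n : nat) (G : seq {ffun 'I_d -> nat}) (J : pred 'I_d).
Hypothesis n2 : 1 < n.
Hypothesis Gn : digits n G.
(** [J] contains every direction in which the digits vary. In the other directions all words of a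
    level agree, and all cells may lie along a face of the cube, so adjacency and faces are tested
    in [J] only. *)
Hypothesis J_const : forall i, ~~ J i -> forall g h, g \in G -> h \in G -> g i = h i.
Implicit Types (u v w g : {ffun 'I_d -> nat}) (S : {ffun 'I_d -> nat} -> Prop).

Definition adjacent v w := forall i, J i -> v i <= (w i).+1 /\ w i <= (v i).+1.

(** A nonempty union of connected components of the adjacency graph on [W]. *)
Definition island (W : seq {ffun 'I_d -> nat}) S :=
  [/\ exists v, S v, forall v, S v -> v \in W &
      forall v w, S v -> w \in W -> adjacent v w -> S w].

Definition off_opposite_faces M S := forall v w i, J i -> S v -> S w ->
  v i = 0 -> w i = M.-1 -> False.

Definition off_faces M S := forall v i, J i -> S v -> 0 < v i < M.-1.

Let W k := words n G k.

Let Wlt k v i : v \in W k -> v i < n ^ k.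
Proof. exact: words_lt. Qed.

Let nk_gt0 k : 0 < n ^ k. Proof. by rewrite expn_gt0; lia. Qed.

(* [(i, false)] and [(i, true)] stand for the faces [x_i = 0] and [x_i = 1]. *)
Definition faces k S : {set 'I_d * bool} :=
  [set p | J p.1 && `[< exists2 v, S v & v p.1 = if p.2 then (n ^ k).-1 else 0 >]].

Lemma facesP k S i b : reflect
  (J i /\ exists2 v, S v & v i = if b then (n ^ k).-1 else 0) ((i, b) \in faces k S).
Proof.
rewrite inE /=; apply: (iffP andP) => -[Ji]; first by move/asboolP.
by move=> H; split => //; apply/asboolP.
Qed.

Section faces_steps.
Variable T : {set 'I_d * bool}.
Hypothesis T_oriented : forall i, (i, false) \in T -> (i, true) \in T -> False.

Definition step v w := forall i, [\/ w i = v i, (i, false) \in T /\ (w i).+1 = v i |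
  (i, true) \in T /\ w i = (v i).+1].

Definition corner M v := forall i,
  ((i, false) \in T -> v i = 0) /\ ((i, true) \in T -> v i = M.-1).

Lemma step_adjacent v w : step v w -> adjacent v w.
Proof. by move=> st i _; case: (st i) => [->|[_ <-]|[_ ->]]; lia. Qed.

Lemma adjacent_sym v w : adjacent v w -> adjacent w v.
Proof. by move=> a i Ji; case: (a i Ji). Qed.

(** When this fails, some word off the corner has no proper step; inside that word a copy of [S]
    will touch fewer faces than [S]. *)
Hypothesis descends : forall j u, u \in W j -> ~ corner (n ^ j) u ->
  exists2 u', u' \in W j & step u u' /\ u' <> u.

(** Steps approach the faces in [T] until the corner is reached. Each step joins adjacent words, so
    it stays in the same islands, and it fixes the directions without a face in [T]. *)
Lemma chain_to_corner j u : u \in W j -> exists u0, [/\ u0 \in W j,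
  corner (n ^ j) u0, forall i, (i, false) \notin T -> (i, true) \notin T -> u0 i = u i &
  forall S, island (W j) S -> S u0 <-> S u].
Proof.
(* The total distance to the faces in [T], which drops at every proper step. *)
pose f v := \sum_(i < d) (((i, false) \in T) * v i + ((i, true) \in T) * ((n ^ j).-1 - v i)).
have [m] := ubnP (f u); elim: m u => // m IH u fm uj.
have [cu|ncu] := pselect (corner (n ^ j) u); first by exists u.
have [u' u'j [st neq]] := descends uj ncu.
have lef i : ((i, false) \in T) * u' i + ((i, true) \in T) * ((n ^ j).-1 - u' i) +
      (u' i != u i) <=
    ((i, false) \in T) * u i + ((i, true) \in T) * ((n ^ j).-1 - u i).
  have := leq_b1 (u' i != u i).
  have := Wlt i u'j; case: (st i) => [->|[Ti e]|[Ti e]]; first by rewrite eqxx addn0.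
    have nT : (i, true) \in T = false by apply/negP => /(T_oriented Ti).
    by rewrite nT Ti -e; move: (u' i) => x; case: (x != x.+1); lia.
  have nT : (i, false) \in T = false by apply/negP => /T_oriented /(_ Ti).
  by rewrite nT Ti e; move: (u' i) (u i) => x y; case: (y.+1 != y); lia.
have fu' : f u' < f u.
  have [i ui] : exists i, u' i != u i.
    apply: contrapT => H; apply: neq; apply/ffunP => i; apply/eqP.
    by apply/negPn/negP => ?; apply: H; exists i.
  rewrite /f (bigD1 i) //= [X in _ < X](bigD1 i) //=.
  rewrite -addSn leq_add //; first by have := lef i; rewrite ui addn1.
  by apply: leq_sum => k _; exact: leq_trans (leq_addr _ _) (lef k).
have [|u0 [u0j cu0 off Su]] := IH u' _ u'j; first by lia.
exists u0; split => // [i T0 T1|S isl].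
  rewrite (off i T0 T1); case: (st i) => [//|[]|[]]; first by rewrite (negPf T0).
  by rewrite (negPf T1).
have [_ _ cl] := isl; have adj := step_adjacent st; rewrite (Su S isl).
by split=> Sx; apply: cl Sx _ _ => //; exact: adjacent_sym.
Qed.

End faces_steps.

Hypothesis J_vary : forall i, J i -> exists g h, [/\ g \in G, h \in G & g i <> h i].

(* With [T] the faces touched by [S]: either some copy [u.S] has no neighbour
   across the faces of [T] and touches fewer faces, or every word is joined to
   the corner of [T] in its fibre, and then [S] reaches opposite faces. *)
Lemma interior_island k S : island (W k) S -> off_opposite_faces (n ^ k) S ->
  exists k' S', [/\ k <= k', island (W k') S' & off_faces (n ^ k') S'].
Proof.
have [m] := ubnP #|faces k S|; elim: m k S => // m IH k S Sm iS opS.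
have [[v0 Sv0] SW cl] := iS.
set T := faces k S.
have T_J i b : (i, b) \in T -> J i by case/facesP.
have T_or i : (i, false) \in T -> (i, true) \in T -> False.
  by move=> /facesP[Ji [v Sv v0i]] /facesP[_ [w Sw wi]]; exact: (opS v w i).
have [/eqP T0|/set0Pn[[i0 b] Ti0]] := boolP (T == finset.set0).
  exists k, S; split => // v i Ji Sv.
  have h0 : v i <> 0.
    move=> e; have: (i, false) \in T by apply/facesP; split => //; exists v.
    by rewrite T0 inE.
  have h1 : v i <> (n ^ k).-1.
    move=> e; have: (i, true) \in T by apply/facesP; split => //; exists v.
    by rewrite T0 inE.
  by have := Wlt i (SW _ Sv); lia.
have [desc|/existsNP[j /existsNP[u]]] := pselect (forall j u, u \in W j ->
    ~ corner T (n ^ j) u -> exists2 u', u' \in W j & step T u u' /\ u' <> u).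
  exfalso.
  (* The corner [w0] joined to [v0] lies in [S]. Put after a digit [u] that is off the face
     [(i0, b)], it gives a word that is not a corner, hence has a step to another word [V']. *)
  have [w0 [w0k cw0 off0 Sw]] := chain_to_corner T_or desc (SW _ Sv0).
  have Sw0 : S w0 by apply/(Sw S).
  have [u Gu uc] : exists2 u, u \in G & u i0 <> if b then n.-1 else 0.
    have [g [h [Gg Gh gh]]] := J_vary (T_J _ _ Ti0).
    have [e|] := pselect (g i0 = if b then n.-1 else 0); last by exists g.
    by exists h => // e'; apply: gh; rewrite e e'.
  have VW : vec_app (n ^ k) u w0 \in W (1 + k).
    by apply/words_addP; exists u, w0; rewrite words1.
  have [|V' V'W [st neq]] := desc _ _ VW.
    move=> /(_ i0)[c0 c1]; case: b Ti0 uc => Ti0 uc; last first.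
      by move: (c0 Ti0); rewrite ffunE => /(first_block (nk_gt0 k))[].
    move: (c1 Ti0); rewrite ffunE expnD expn1.
    case/last_block => //; [lia|exact: Wlt].
  have [u' [w' [Gu' w'k eV']]] := (words_addP _ _ _ _ _).1 V'W.
  have off i : (i, false) \notin T -> (i, true) \notin T -> w' i = w0 i.
    move=> T0 T1; case: (st i) => [|[]|[]]; rewrite ?(negPf T0) ?(negPf T1) //.
    by rewrite eV' !ffunE => /div_mod_unique[] //; exact: Wlt.
  (* [w'] agrees with [w0] in the directions without a face in [T], so it leads to the same corner
     and belongs to [S]. *)
  have [w1 [w1k cw1 off1 Sw']] := chain_to_corner T_or desc w'k.
  have e1 : w1 = w0.
    apply/ffunP => i; have [T0|T0] := boolP ((i, false) \in T).
      by rewrite (cw1 i).1 // (cw0 i).1.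
    have [T1|T1] := boolP ((i, true) \in T); first by rewrite (cw1 i).2 // (cw0 i).2.
    by rewrite off1 // off.
  have Sw'' : S w' by apply/(Sw' S iS); rewrite e1.
  (* As [w0] is extreme in any direction that moves, the step borrows from [u] or carries into it.
     Then [w'] is at the other extreme, and [S] reaches opposite faces. *)
  apply: neq; apply/ffunP => i; case: (st i) => [//|[Ti]|[Ti]].
    rewrite eV' !ffunE (cw0 i).1 // addn0 => e; exfalso.
    apply: (opS w0 w' i); rewrite ?(cw0 i).1 //; first exact: T_J Ti.
    have ui : 0 < u i by rewrite lt0n; apply/eqP => u0; move: e; rewrite u0.
    have: u' i * n ^ k + w' i = (u i * n ^ k).-1 by rewrite -e.
    by case/last_block => //; exact: Wlt.
  rewrite eV' !ffunE (cw0 i).2 // => e; exfalso.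
  apply: (opS w' w0 i); rewrite ?(cw0 i).2 //; first exact: T_J Ti.
  have: u' i * n ^ k + w' i = (u i).+1 * n ^ k + 0.
    by rewrite e mulSn addn0 -addnS prednK // addnC.
  by case/div_mod_unique => //; exact: Wlt.
move=> /not_implyP[uj /not_implyP[ncu nst]].
(* Here [u] is off the corner and has no proper step; [S'] is the copy of [S] inside [u]. *)
pose S' v := exists2 w, S w & v = vec_app (n ^ k) u w.
have faceS' w i (b' : bool) : S w ->
    u i * n ^ k + w i = (if b' then (n ^ (j + k)).-1 else 0) ->
    u i = (if b' then (n ^ j).-1 else 0) /\ w i = (if b' then (n ^ k).-1 else 0).
  move=> Sw; rewrite expnD; have := nk_gt0 k; case: b' => k0 e; last exact: first_block e.
  by apply: last_block e => //; exact: Wlt (SW _ Sw).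
have [|||k' [S2 [le iS2 oS2]]] := IH (j + k) S'; last first.
- by exists k', S2; split => //; exact: leq_trans (leq_addl _ _) le.
- move=> _ _ i Ji [v Sv ->] [w Sw ->]; rewrite !ffunE => e0 e1.
  have [_ v0i] := faceS' _ _ false Sv e0; have [_ w1i] := faceS' _ _ true Sw e1.
  exact: (opS v w i).
- split.
  + by exists (vec_app (n ^ k) u v0), v0.
  + by move=> _ [w Sw ->]; apply/words_addP; exists u, w; split => //; exact: SW.
  move=> _ v' [w Sw ->] /words_addP[u' [w' [u'j w'k ->]]] adj.
  have nb i : J i -> [\/ [/\ u i = u' i, w i <= (w' i).+1 & w' i <= (w i).+1],
      [/\ u i = (u' i).+1, w i = 0 & w' i = (n ^ k).-1] |
      [/\ u' i = (u i).+1, w i = (n ^ k).-1 & w' i = 0]].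
    move=> Ji; have := adj i Ji; rewrite !ffunE => -[]; apply: near_blocks.
      exact: Wlt (SW _ Sw).
    exact: Wlt.
  (* Leaving [u] in some direction requires a word of [S] on the face that is crossed, so [u'] would
     be a proper step from [u]. *)
  have e : u' = u.
    apply: contrapT => neq; apply: nst; exists u' => //; split => // i.
    have [Ji|Ji] := boolP (J i); last first.
      by apply: Or31; apply: (words_const (J_const Ji) u'j uj).
    case: (nb i Ji) => [[e _ _]|[e wi _]|[e wi _]]; first exact: Or31.
      by apply: Or32; split => //; apply/facesP; split => //; exists w.
    by apply: Or33; split => //; apply/facesP; split => //; exists w.
  exists w'; last by rewrite e.
  apply: (cl w w') => // i Ji; case: (nb i Ji) => [[_ ? ?]//|[]|[]]; rewrite e; lia.
- apply: (@leq_trans #|T|); last exact: Sm.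
  (* A face touched by [S'] is touched by [S] and by [u], and [u] misses some face of [T]. *)
  apply: proper_card; apply/properP; split.
    apply/fintype.subsetP => -[i b'] /facesP[Ji [_ [w Sw ->]]]; rewrite ffunE => e.
    by apply/facesP; split => //; exists w => //; case: (faceS' _ _ _ Sw e).
  have [i [b' [Ti ui]]] :
      exists i b', (i, b') \in T /\ u i <> if b' then (n ^ j).-1 else 0.
    apply: contrapT => H; apply: ncu => i; split=> Ti; apply: contrapT => ui.
      by apply: H; exists i, false.
    by apply: H; exists i, true.
  exists (i, b') => //; apply/negP => /facesP[Ji [_ [w Sw ->]]]; rewrite ffunE => e.
  by case: (faceS' _ _ _ Sw e).
Qed.

End islands.

Local Open Scope classical_set_scope.
Local Open Scope ring_scope.

(** * Chain components of a compact set *)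

Lemma near_right_ex {R : realType} (P : R -> Prop) :
  (\forall e \near 0^'+, P e) -> exists2 e, 0 < e & P e.
Proof.
by move=> H; near (0 : R)^'+ => e; exists e; near: e => //; exact: nbhs_right_gt.
Unshelve. all: by end_near. Qed.

Section chain_components.
Context {R : realType} {V : normedModType R}.
Variables (E : set V) (x : V).
Hypothesis cE : compact E.
Hypothesis Ex : E x.

(* The points joined to [x] by chains in [E] with steps shorter than [e]. *)
Definition chain_component (e : R) : set V := [set y | forall C : set V, C x ->
  (forall a b, C a -> E b -> `|a - b| < e -> C b) -> C y].

Lemma chain_component_refl e : chain_component e x.
Proof. by move=> C. Qed.

Lemma chain_component_step e a b :
  chain_component e a -> E b -> `|a - b| < e -> chain_component e b.
Proof. by move=> aC Eb ab C Cx Cs; exact: (Cs a b (aC C Cx Cs)). Qed.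

Lemma chain_component_sub e : chain_component e `<=` E.
Proof. by move=> y /(_ E Ex); apply. Qed.

Lemma chain_component_mono e e' : e <= e' -> chain_component e `<=` chain_component e'.
Proof.
move=> ee' y yC C Cx Cs; apply: yC => // a b Ca Eb ab.
by apply: (Cs a) => //; exact: lt_le_trans ee'.
Qed.

Let closedE : closed E.
Proof. exact: compact_closed. Qed.

Lemma chain_component_closed e : 0 < e -> closed (chain_component e).
Proof.
move=> e0 z zcl; have Ez : E z.
  by apply: closedE; apply: closureS zcl; exact: chain_component_sub.
have [y [yC]] := zcl _ (nbhsx_ballx z e e0).
rewrite -ball_normE /= => zy.
by apply: (chain_component_step yC) => //; rewrite distrC.
Qed.

(** For compact [E] this set is connected, hence contained in the component of [x]. *)
Definition chain_limit : set V := \bigcap_(e in [set e | 0 < e]) chain_component e.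

(** A point of [E] outside [U] avoids some chain component. That component is closed, so nearby
    points avoid it and all smaller ones; compactness of [E] then provides a single [e]. *)
Lemma chain_limit_nbhs U : open U -> chain_limit `<=` U ->
  exists2 e, 0 < e & chain_component e `<=` U.
Proof.
move=> oU QU.
have /compact_near_coveringP nc := cE.
have : \forall e \near 0^'+, E `<=` [set a | chain_component e a -> U a].
  apply: (nc _ _ (fun e a => chain_component e a -> U a)) => a Ea.
  have [Ua|nUa] := pselect (U a).
    exists (U, setT); first by split; [exact: open_nbhs_nbhs|exact: filterT].
    by move=> [b e] [].
  have [e0 e00 nCa] : exists2 e0, 0 < e0 & ~ chain_component e0 a.
    apply: contrapT => H; apply: nUa; apply: QU => e /= e0.
    by apply: contrapT => nC; apply: H; exists e.
  exists (~` chain_component e0, [set e | e <= e0]).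
    split; last exact: nbhs_right_le.
    apply: open_nbhs_nbhs; split => //; apply: closed_openC.
    exact: chain_component_closed.
  by move=> [b e] /= [nb ee0] /(chain_component_mono ee0).
move=> /near_right_ex[e e0 He].
by exists e => // a aC; apply: He => //; exact: chain_component_sub aC.
Qed.

Lemma compact_closed_gap (B L : set V) : compact B -> closed L -> B `&` L = set0 ->
  exists2 e : R, 0 < e & forall a b, B a -> L b -> e <= `|a - b|.
Proof.
move=> /compact_near_coveringP nc cL BL.
have : \forall e \near 0^'+, B `<=` [set a | forall b, L b -> e <= `|a - b|].
  apply: (nc _ _ (fun e a => forall b, L b -> e <= `|a - b|)) => a Ba.
  have : nbhs a (~` L).
    apply: open_nbhs_nbhs; split; first exact: closed_openC.
    by move=> La; have : (B `&` L) a by []; rewrite BL.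
  move=> /nbhs_ballP[r /= r0 rL].
  exists (ball a (r / 2), [set e | e <= r / 2]).
    by split; [apply: nbhsx_ballx|apply: nbhs_right_le]; rewrite divr_gt0.
  move=> [a' e] /= []; rewrite -ball_normE /= => aa' er b Lb.
  have : ~ `|a - b| < r by move=> ab; apply: (rL b) => //; rewrite -ball_normE.
  move=> /negP; rewrite -leNgt => rab.
  have := ler_distD a' a b; lra.
move=> /near_right_ex[e e0 He].
by exists e => // a b /He; apply.
Qed.

Lemma chain_limit_closed : closed chain_limit.
Proof. by apply: closed_bigI => e; exact: chain_component_closed. Qed.

Lemma chain_limit_sub : chain_limit `<=` E.
Proof. by move=> y /(_ 1 ltr01); exact: chain_component_sub. Qed.

(** Thicken both parts by [e / 3]. For small steps the chain component lies in the two thickenings,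
    and a step shorter than [e / 3] cannot pass from one to the other, so chains from [x] stay near
    [B]. *)
Lemma chain_limit_not_separated (B L : set V) (e : R) : 0 < e ->
  (forall a b, B a -> L b -> e <= `|a - b|) ->
  chain_limit = B `|` L -> B x -> L = set0.
Proof.
move=> e0 BL QBL Bx.
pose N (A : set V) := \bigcup_(a in A) ball a (e / 3).
have e30 : 0 < e / 3 by rewrite divr_gt0.
have [e1 e10 CU] : exists2 e1, 0 < e1 & chain_component e1 `<=` N B `|` N L.
  apply: chain_limit_nbhs.
    by apply: openU; apply: bigcup_open => a _; exact: ball_open.
  by rewrite QBL => y [By|Ly]; [left|right]; exists y => //; exact: ballxx.
have [e2 [e20 e21 e23]] : exists e2, [/\ 0 < e2, e2 <= e1 & e2 <= e / 3].
  by exists (Num.min e1 (e / 3)); rewrite lt_min e10 e30 ge_min ge_min !lexx orbT.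
have CN : chain_component e2 `<=` chain_component e2 `&` N B.
  move=> y; apply.
    by split; [exact: chain_component_refl|exists x => //; exact: ballxx].
  move=> a b [Ca [a' Ba' +]] Eb ab; rewrite -ball_normE /= => aa'.
  have Cb := chain_component_step Ca Eb ab; split => //.
  case: (CU b (chain_component_mono e21 Cb)) => // -[b' Lb'].
  rewrite -ball_normE /= distrC => bb'; exfalso.
  have := BL _ _ Ba' Lb'; have := ler_distD a a' b'; have := ler_distD b a b'; lra.
rewrite -subset0 => b Lb; have Qb : chain_limit b by rewrite QBL; right.
have [_ [a Ba]] := CN _ (Qb e2 e20); rewrite -ball_normE /= => ab.
have := BL _ _ Ba Lb; lra.
Qed.

(** A relatively clopen part and its complement are compact, hence at positive distance; the one
    without [x] must be empty. *)
Lemma chain_limit_connected : connected chain_limit.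
Proof.
move=> B [b Bb] [U oU BU] [C cC BC].
have cQ : compact chain_limit.
  by apply: subclosed_compact cE _; [exact: chain_limit_closed|exact: chain_limit_sub].
have cB : compact B by rewrite BC; exact: compact_closedI.
pose L := chain_limit `&` ~` U.
have cL : closed L by apply: closedI; [exact: chain_limit_closed|exact: open_closedC].
have BL0 : B `&` L = set0.
  by rewrite -subset0 BU => z [[_ Oz] [_ /(_ Oz)]].
have QBL : chain_limit = B `|` L.
  by rewrite BU /L -setIUr setUv setIT.
have [e e0 gap] := compact_closed_gap cB cL BL0.
have Qx : chain_limit x by move=> e1 _; exact: chain_component_refl.
move: (Qx); rewrite {1}QBL => -[Bx|Lx].
  by have L0 := chain_limit_not_separated e0 gap QBL Bx; rewrite QBL L0 setU0.
have gap' a' b' : L a' -> B b' -> e <= `|a' - b'| by rewrite distrC => ? ?; exact: gap.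
rewrite setUC in QBL.
by have B0 := chain_limit_not_separated e0 gap' QBL Lx; rewrite B0 in Bb.
Qed.

Lemma trivial_chain_component r : connected_component E x = [set x] -> 0 < r ->
  exists2 e, 0 < e & chain_component e `<=` ball x r.
Proof.
move=> xE r0; apply: chain_limit_nbhs; first exact: ball_open.
have : chain_limit `<=` connected_component E x.
  apply: connected_component_max; [|exact: chain_limit_sub|exact: chain_limit_connected].
  by move=> e _; exact: chain_component_refl.
by rewrite xE => Qx y /Qx ->; exact: ballxx.
Qed.

End chain_components.

(** * Cells of a fractal cube *)

Lemma pow_beats {R : realType} (n : nat) (C e : R) : (1 < n)%N -> 0 < e ->
  exists2 k, (0 < k)%N & C < e * (n ^ k)%:R.
Proof.
move=> n1 e0; exists (Num.truncn (C / e)).+1 => //.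
rewrite mulrC -ltr_pdivrMr //; apply: lt_trans (truncnS_gt _) _.
by rewrite ltr_nat ltn_expl.
Qed.

Section row_vectors.
Context {R : realType} {d : nat}.
Implicit Types x y : 'rV[R]_d.

Lemma rV_norm_lt x y e : 0 < e ->
  (forall i, `|x 0 i - y 0 i| < e) <-> `|x - y| < e.
Proof.
move=> e0; split => [H|H i].
  have : ball x e y by split=> // i j; rewrite -ball_normE /= ord1.
  by rewrite -ball_normE.
have : ball x e y by rewrite -ball_normE.
by case=> _ /(_ 0 i); rewrite -ball_normE.
Qed.

Definition rvec (v : {ffun 'I_d -> nat}) : 'rV[R]_d := \row_i (v i)%:R.

Lemma rvec_app M u w : rvec (vec_app M u w) = M%:R *: rvec u + rvec w.
Proof. by apply/rowP => i; rewrite !mxE ffunE natrD natrM mulrC. Qed.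

(** For [M > 0] this is the copy $(E+v)/M$, written as a preimage so that closedness and nesting are
    immediate. *)
Definition cell (E : set 'rV[R]_d) (M : nat) v : set 'rV[R]_d :=
  [set x | E (M%:R *: x - rvec v)].

(** Digits are vectors of natural numbers in a list, so that the words of length [k] can serve as
    digits of the same set in base [n ^ k]. *)
Definition fractal (n : nat) G (E : set 'rV[R]_d) : Prop :=
  [/\ E !=set0, compact E, digits n G, uniq G &
      forall x, E x <-> exists2 g, g \in G & cell E n g x].

Lemma cell_app E M M' u w x : cell E (M * M') (vec_app M' u w) x <->
  cell E M' w (M%:R *: x - rvec u).
Proof.
rewrite /cell /= rvec_app natrM; rewrite scalerBr scalerA mulrC opprD addrA.
by [].
Qed.

Lemma fractal_of_cube (n : nat) (D : {set 'rV['I_n]_d}) E : (0 < n)%N ->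
  is_fractal_cube D E ->
  exists2 G, fractal n G E & size G = #|D|.
Proof.
move=> n0 [E0 cE ED]; pose f (a : 'rV['I_n]_d) : {ffun 'I_d -> nat} := [ffun i => a 0 i : nat].
have rf a : rvec (f a) = digit_vector a by apply/rowP => i; rewrite !mxE ffunE.
have nu : n%:R != 0 :> R by rewrite pnatr_eq0 -lt0n.
exists [seq f a | a <- enum D]; last by rewrite size_map -cardE.
split => //.
- by move=> _ /mapP[a _ ->] i; rewrite ffunE.
- rewrite map_inj_uniq ?enum_uniq // => a b /ffunP ab.
  by apply/rowP => i; apply/val_inj; have := ab i; rewrite !ffunE.
- move=> x; split=> [|[_ /mapP[a aD ->] xc]].
    rewrite {1}ED => -[z Ez [a aD <-]]; exists (f a).
      by apply/mapP; exists a; rewrite ?mem_enum.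
    by rewrite /cell /= rf scalerA divff // scale1r addrK.
  rewrite ED; exists (n%:R *: x - rvec (f a)) => //; exists a.
    by move: aD; rewrite mem_enum.
  by rewrite rf subrK scalerA mulVf // scale1r.
Qed.

End row_vectors.

Section fractal_theory.
Context {R : realType} {d : nat}.
Variables (n : nat) (G : seq {ffun 'I_d -> nat}) (E : set 'rV[R]_d).
Hypothesis n2 : (1 < n)%N.
Hypothesis frE : fractal n G E.
Implicit Types (x y : 'rV[R]_d) (u v w g : {ffun 'I_d -> nat}).

Lemma fractal_words k x : E x <-> exists2 v, v \in words n G k & cell E (n ^ k) v x.
Proof.
have [_ _ _ _ EG] := frE.
elim: k x => [|k IH] x.
  have e0 v : v \in words n G 0 -> cell E (n ^ 0) v x <-> E x.
    rewrite inE => /eqP ->; rewrite /cell /= expn0 scale1r.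
    rewrite (_ : rvec _ = 0) ?subr0 //.
    by apply/rowP => i; rewrite !mxE ffunE.
  split=> [Ex|[v v0 /(e0 v v0)//]].
  exists [ffun=> 0%N]; first by rewrite inE.
  by apply/e0 => //; rewrite inE.
rewrite expnSr; split=> [/IH[u uk /EG[g Gg xg]]|]; last first.
  move=> [_ /allpairsP[[u g] /= [uk Gg ->]] /cell_app H].
  by apply/IH; exists u => //; apply/EG; exists g.
by exists (vec_app n u g); [apply/allpairsP; exists (u, g)|exact/cell_app].
Qed.

Lemma fractal_power k : fractal (n ^ k) (words n G k) E.
Proof.
have [E0 cE Gn uG _] := frE; split => //.
- by move=> v vk i; exact: (words_lt _ Gn vk).
- exact: words_uniq.
- exact: fractal_words.
Qed.

Lemma fractal_closed : closed E.
Proof. by have [_ cE _ _ _] := frE; exact: compact_closed. Qed.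

Lemma cell_closed M v : closed (cell E M v).
Proof.
have c : continuous (fun x : 'rV[R]_d => M%:R *: x - rvec v).
  move=> x; apply: (@continuousB _ _ _ (fun x => M%:R *: x) (fun=> rvec v)).
    exact: scaler_continuous.
  exact: cst_continuous.
by move/continuous_closedP: c => /(_ E fractal_closed).
Qed.

(** If $y$ minimises coordinate $i$ on $E$ and lies in the cell of $g$, then $ny-g \in E$ gives
    $ny_i-g_i \ge y_i$, so $y_i \ge 0$. The maximum is bounded in the same way, with $g_i \le
    n-1$. *)
Lemma fractal_unit x i : E x -> 0 <= x 0 i <= 1.
Proof.
have [E0 cE Gn _ EG] := frE; move=> Ex.
have cc : {within E, continuous (fun x : 'rV[R]_d => x 0 i)}.
  by apply: continuous_subspaceT => y; exact: coord_continuous.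
have n1 : 1 < n%:R :> R by rewrite ltr1n.
apply/andP; split.
  have [y /set_mem Ey ymin] := compact_EVT_min E0 cE cc.
  apply: le_trans (ymin x (mem_set Ex)).
  have /EG[g Gg Eg] := Ey; have := ymin _ (mem_set Eg); rewrite !mxE.
  have := ler0n R (g i); nra.
have [y /set_mem Ey ymax] := compact_EVT_max E0 cE cc.
apply: le_trans (ymax x (mem_set Ex)) _.
have /EG[g Gg Eg] := Ey; have := ymax _ (mem_set Eg); rewrite !mxE.
have : (g i)%:R + 1 <= n%:R :> R by rewrite natr1 ler_nat (Gn _ Gg).
nra.
Qed.

Lemma cell_coord M v x i : cell E M v x -> (v i)%:R <= M%:R * x 0 i <= (v i)%:R + 1.
Proof. by move=> /(fractal_unit i); rewrite !mxE => H; lra. Qed.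

Lemma cell_nonempty M v : (0 < M)%N -> cell E M v !=set0.
Proof.
move=> M0; have [[y Ey] _ _ _ _] := frE; exists (M%:R^-1 *: (y + rvec v)).
have Mu : M%:R != 0 :> R by rewrite pnatr_eq0 -lt0n.
by rewrite /cell /= scalerA divff // scale1r addrK.
Qed.

Lemma cell_parent M u g x : g \in G -> cell E (M * n) (vec_app n u g) x -> cell E M u x.
Proof. by have [_ _ _ _ EG] := frE; move=> Gg /cell_app H; apply/EG; exists g. Qed.

Lemma words_cell_sub k v : v \in words n G k -> cell E (n ^ k) v `<=` E.
Proof. by move=> vk x xv; apply/(fractal_words k); exists v. Qed.

Variable J : pred 'I_d.
Hypothesis J_const : forall i, ~~ J i -> forall g h, g \in G -> h \in G -> g i = h i.

(** The island consists of the level-[k] words whose cells meet a small chain component of [x]. *)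
Lemma trivial_island x : trivial_point E x -> exists k S,
  [/\ (0 < k)%N, island J (words n G k) S & off_opposite_faces J (n ^ k) S].
Proof.
move=> [Ex xE]; have [_ cE Gn _ _] := frE.
have r0 : 0 < 4^-1 :> R by rewrite invr_gt0.
have [e e0 CC] := trivial_chain_component cE Ex xE r0.
(* Having $2/n^k < e$ turns adjacency of cells into a chain step. Having $2/n^k < 1/4$ keeps cells
   at opposite faces more than $1/2$ apart, too far for a ball of radius $1/4$. *)
have m0 : 0 < Num.min e 4^-1 by rewrite lt_min e0.
have [k k0 hk] := pow_beats 2 n2 m0.
have M0 : (0 < n ^ k)%N by rewrite expn_gt0; lia.
have M0' : 0 < (n ^ k)%:R :> R by rewrite ltr0n.
have hke : 2 < e * (n ^ k)%:R.
  by apply: (lt_le_trans hk); rewrite ler_pM2r // ge_min lexx.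
have hk4 : 2 < 4^-1 * (n ^ k)%:R :> R.
  by apply: (lt_le_trans hk); rewrite ler_pM2r // ge_min lexx orbT.
exists k, (fun v => v \in words n G k /\
  exists2 y, cell E (n ^ k) v y & chain_component E x e y).
split => //.
- split.
  + have /(fractal_words k)[v vk xv] := Ex; exists v; split => //; exists x => //.

  + by move=> v [].
  + move=> v w [vk [y yv yC]] wk adj; split => //.
    have [z zw] := cell_nonempty w M0; exists z => //.
    apply: (chain_component_step yC); first exact: words_cell_sub zw.
    apply/rV_norm_lt => // i.
    have /andP[y1 y2] := cell_coord i yv; have /andP[z1 z2] := cell_coord i zw.
    have [a b] : ((v i)%:R <= (w i)%:R + 1 :> R) /\ ((w i)%:R <= (v i)%:R + 1 :> R).
      have [Ji|Ji] := boolP (J i).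
        by have [a b] := adj i Ji; rewrite !natr1 !ler_nat.
      by rewrite (words_const (J_const Ji) vk wk); split; rewrite lerDl.
    rewrite ltr_norml; apply/andP; split; nra.
- move=> v w i Ji [vk [y yv yC]] [wk [z zw zC]] vi wi.
  have /andP[y1 y2] := cell_coord i yv; have /andP[z1 z2] := cell_coord i zw.
  move: (CC _ yC) (CC _ zC); rewrite -!ball_normE /=.
  move=> /(rV_norm_lt _ _ r0)/(_ i) yr /(rV_norm_lt _ _ r0)/(_ i) zr.
  rewrite ltr_norml in yr; rewrite ltr_norml in zr.
  have wi' : (w i)%:R + 1 = (n ^ k)%:R :> R by rewrite wi natr1 prednK.
  rewrite vi in y2; case/andP: yr => yr1 yr2; case/andP: zr => zr1 zr2.
  have zy : z 0 i - y 0 i < 2^-1 by lra.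
  rewrite -(ltr_pM2l M0') mulrBr in zy.
  suff : (n ^ k)%:R * 2^-1 <= (n ^ k)%:R * z 0 i - (n ^ k)%:R * y 0 i by rewrite leNgt zy.
  by lra.
Qed.

End fractal_theory.

(** * Lower bound for the Hausdorff dimension *)

Lemma ler_euclidean_dist {R : realType} {d : nat} (x y : 'rV[R]_d) i :
  `|x 0 i - y 0 i| <= euclidean_dist x y.
Proof.
rewrite -sqrtr_sqr ler_sqrt ?sumr_ge0 // => [|j _]; last exact: sqr_ge0.
by rewrite (bigD1 i) //= lerDl sumr_ge0 // => j _; exact: sqr_ge0.
Qed.

Lemma size_le_sum_count (T : eqType) (s : seq T) L (P : nat -> pred T) :
  (forall v, v \in s -> exists2 i, (i < L)%N & P i v) ->
  (size s <= \sum_(0 <= i < L) count (P i) s)%N.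
Proof.
elim: s => [|v s IH] H; first by rewrite /=.
have [i iL Pi] := H v (mem_head _ _).
rewrite [X in (_ <= X)%N](_ : _ = \sum_(0 <= j < L) P j v + \sum_(0 <= j < L) count (P j) s)%N.
  rewrite /= -add1n leq_add //; last by apply: IH => w ws; apply: H; rewrite inE ws orbT.
  by rewrite (bigD1_seq i) ?mem_index_iota ?iota_uniq //= Pi.
by rewrite -big_split.
Qed.

Section lower_bound.
Context {R : realType} {d : nat}.
Variables (n : nat) (G : seq {ffun 'I_d -> nat}) (E : set 'rV[R]_d).
Hypothesis n2 : (1 < n)%N.
Hypothesis frE : fractal n G E.
Hypothesis N2 : (1 < size G)%N.
Implicit Types (x y p : 'rV[R]_d) (u v w g : {ffun 'I_d -> nat}).
Let N := size G.
Let nk_gt0 k : (0 < n ^ k)%N. Proof. by rewrite expn_gt0; lia. Qed.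
Let nkR_gt0 k : 0 < (n ^ k)%:R :> R. Proof. by rewrite ltr0n. Qed.

(** The scale [k] of the box is independent of the scale [M] of the cell: boxes of a cover have
    various sizes, while cells are counted at one common level. *)
Definition box_meets k p M v :=
  `[< exists2 y, cell E M v y & forall i, `|y 0 i - p 0 i| < 2 / (n ^ k)%:R >].

Lemma count_box_meets0 k p : (count (box_meets k p (n ^ k)) (words n G k) <= 6 ^ d)%N.
Proof.
have [_ _ Gn uG _] := frE.
(* With $P = n^k p_i$, a cell meeting the box has $P-3 < u_i < P+2$, so six values from the
   truncation of $P-3$ suffice; the truncation is 0 if $P-3$ is negative. *)
pose b i := Num.truncn ((n ^ k)%:R * p 0 i - 3).
pose sh (f : {ffun 'I_d -> 'I_6}) : {ffun 'I_d -> nat} := [ffun i => (b i + f i)%N].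
pose s := map sh (enum {: {ffun 'I_d -> 'I_6}}).
have -> : (6 ^ d = size s)%N by rewrite size_map -cardE card_ffun !card_ord.
rewrite -size_filter; apply: uniq_leq_size; first by rewrite filter_uniq // words_uniq.
move=> u; rewrite mem_filter => /andP[/asboolP[y yu yp] uk].
have ub i : (b i <= u i < b i + 6)%N.
  have /andP[y1 y2] := cell_coord n2 frE i yu.
  have := yp i; rewrite ltr_pdivlMr // -[X in _ * X]gtr0_norm // -normrM mulrC.
  rewrite ltr_norml mulrBr => /andP[h1 h2].
  rewrite /b; set P := (n ^ k)%:R * p 0 i in h1 h2 *.
  set Y := (n ^ k)%:R * y 0 i in y1 y2 h1 h2.
  have tS := truncnS_gt (P - 3).
  apply/andP; split.
    have [P0|P0] := leP 0 (P - 3); last by rewrite truncn_floor leNgt P0.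
    rewrite -(ler_nat R); have := truncn_itv P0 => /andP[h _]; lra.
  rewrite -(ltr_nat R) natrD.
  move: tS; rewrite -natr1 => tS; lra.
apply/mapP; exists [ffun i => inord (u i - b i)]; first by rewrite mem_enum.
apply/ffunP => i; rewrite !ffunE inordK; have := ub i; lia.
Qed.

Lemma count_box_meets k q p :
  (count (box_meets k p (n ^ (k + q))) (words n G (k + q)) <= 6 ^ d * N ^ q)%N.
Proof.
have [_ _ Gn uG EG] := frE.
pose A := [seq u <- words n G k | box_meets k p (n ^ k) u].
have A6 : (size A <= 6 ^ d)%N by rewrite size_filter count_box_meets0.
apply: (@leq_trans (size [seq vec_app (n ^ q) u w | u <- A, w <- words n G q])); last first.
  by rewrite size_allpairs size_words leq_mul.
rewrite -size_filter; apply: uniq_leq_size; first by rewrite filter_uniq // words_uniq.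
move=> v; rewrite mem_filter => /andP[/asboolP[y yv yp]] /words_addP[u [w [uk wq ev]]].
apply/allpairsP; exists (u, w); split => //=; rewrite mem_filter uk andbT.
apply/asboolP; exists y => //.
move: yv; rewrite ev expnD => /cell_app yw.
by apply/(fractal_words frE q); exists w.
Qed.

(** Replaces [F] by a box at the [n]-adic scale of its diameter $D$: from $1 < D n^{k+1}$ and $n^s
    \le N$ follows $N^{-k} \le N D^s$. The term [e] pays for sets that are empty or of diameter
    zero. *)
Lemma cover_scale (s e : R) (F : set 'rV[R]_d) : 0 <= s -> n%:R `^ s <= N%:R -> 0 < e ->
  (diameter euclidean_dist F <= 1%:E)%E ->
  exists p k, (forall y, F y -> forall i, `|y 0 i - p 0 i| <= (n ^ k)%:R^-1) /\
    (((N ^ k)%:R^-1)%:E <= N%:R%:E * diameter_pow euclidean_dist s F + e%:E)%E.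
Proof.
move=> s0 nsN e0 F1.
have [k0 _ Nk0] := @pow_beats R N 1 e N2 e0.
have N0 k : 0 < (N ^ k)%:R :> R by rewrite ltr0n expn_gt0; rewrite /N; lia.
have dp0 : (0 <= diameter_pow euclidean_dist s F)%E.
  by rewrite /diameter_pow; case: ifP => // _; exact: poweR_ge0.
have small : (((N ^ k0)%:R^-1)%:E <= N%:R%:E * diameter_pow euclidean_dist s F + e%:E)%E.
  apply: (@le_trans _ _ e%:E); last by rewrite leeDr // mule_ge0 // lee_fin ler0n.
  by rewrite lee_fin -[X in X <= _]div1r ler_pdivrMr // ltW.
have [F0|/set0P[p Fp]] := eqVneq F set0.
  by exists 0, k0; split => // y; rewrite F0.
have dF a b : F a -> F b -> ((euclidean_dist a b)%:E <= diameter euclidean_dist F)%E.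
  by move=> Fa Fb; apply: ereal_sup_ubound; exists (a, b).
have dd x : euclidean_dist x x = 0 :> R.
  rewrite /euclidean_dist big1 ?sqrtr0 // => i _; by rewrite subrr expr0n.
have diam_fin : diameter euclidean_dist F \is a fin_num.
  rewrite fin_numE; apply/andP; split.
    by apply/eqP => H; have := dF p p Fp Fp; rewrite H dd.
  by apply/eqP => H; move: F1; rewrite H.
set D := fine (diameter euclidean_dist F).
have ED : diameter euclidean_dist F = D%:E by rewrite fineK.
have D0 : 0 <= D by have := dF p p Fp Fp; rewrite ED dd lee_fin.
have D1 : D <= 1 by rewrite ED lee_fin in F1.
have Fcoord y i : F y -> `|y 0 i - p 0 i| <= D.
  move=> Fy; apply: le_trans (ler_euclidean_dist _ _ _) _.
  by have := dF y p Fy Fp; rewrite ED lee_fin.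
have [Dz|Dn0] := eqVneq D 0.
  exists p, k0; split => // y Fy i; apply: le_trans (Fcoord y i Fy) _.
  by rewrite Dz invr_ge0 ler0n.
have Dp : 0 < D by rewrite lt0r Dn0.
have exk : exists k, 1 < D * (n ^ k.+1)%:R.
  have [k _ hk] := @pow_beats R n 1 D n2 Dp; exists k; apply: lt_le_trans hk _.
  by rewrite ler_pM2l // ler_nat leq_exp2l.
(* Minimality of [k] gives $D \le n^{-k}$; for $k = 0$ this is the assumption $D \le 1$. *)
case: (ex_minnP exk) => k hk kmin.
exists p, k; split.
  move=> y Fy i; apply: le_trans (Fcoord y i Fy) _.
  rewrite -[leRHS]div1r ler_pdivlMr //; case: k kmin hk => [|k] kmin hk.
    by rewrite expn0 mulr1.
  by rewrite leNgt; apply/negP => /kmin; rewrite ltnn.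
have -> : diameter_pow euclidean_dist s F = (D `^ s)%:E.
  rewrite /diameter_pow ifF ?ED ?poweR_EFin //.
  by apply/negP => /eqP F0; rewrite F0 in Fp.
apply: (@le_trans _ _ (N%:R * D `^ s)%:E); last by rewrite EFinM leeDl // lee_fin ltW.
rewrite lee_fin -[X in X <= _]div1r ler_pdivrMr // (mulrC N%:R) -mulrA -natrM -expnS.
have := ler_powR (ltW hk) s0; rewrite powRr0 powRM // ?ler0n // => h1; apply: le_trans h1 _.
rewrite ler_pM2l ?powR_gt0 // natrX -powR_mulrn ?ler0n // powRAC powR_mulrn ?powR_ge0 //.
by rewrite natrX lerXn2r // ?nnegrE ?powR_ge0 ?ler0n.
Qed.

(** If $n^s < N$, a cheap cover becomes finitely many boxes of scales $k_i$. Counting cells at a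
    common level $K$ gives $N^K \le \sum_i 6^d N^{K-k_i}$, against the smallness of $\sum_i
    N^{-k_i}$. *)
Lemma fractal_dim_ge s : 0 <= s -> hausdorff_measure euclidean_dist s E = 0%E ->
  N%:R <= n%:R `^ s.
Proof.
move=> s0 Hs; rewrite leNgt; apply/negP => nsN.
have [_ cE _ _ _] := frE.
have N0 k : 0 < (N ^ k)%:R :> R by rewrite ltr0n expn_gt0; rewrite /N; lia.
pose B : R := (6 ^ d)%:R.
have B0 : 0 < B by rewrite ltr0n expn_gt0.
(* The cover costs at most [e / N] and the error terms add up to [e], so $\sum_i N^{-k_i} \le 2e$,
   and $6^d \cdot 2e = 1/2 < 1$. *)
pose e : R := (4 * B)^-1.
have e0 : 0 < e by rewrite invr_gt0 mulr_gt0.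
have NR0 : 0 < N%:R :> R by rewrite ltr0n /N; lia.
have [F [EF F1] Fs] : exists2 F : nat -> set 'rV[R]_d,
   (E `<=` \bigcup_i F i /\ forall i, (diameter euclidean_dist (F i) <= 1%:E)%E) &
   (\sum_(0 <= i <oo) diameter_pow euclidean_dist s (F i) < (e / N%:R)%:E)%E.
  have : (hausdorff_premeasure euclidean_dist s 1 E < (e / N%:R)%:E)%E.
    apply: le_lt_trans (_ : 0 < _)%E; last by rewrite lte_fin divr_gt0.
    by rewrite -Hs; apply: ereal_sup_ubound; exists 1 => //=.
  by move=> /ereal_inf_lt[_ [F HF <-] ?]; exists F.
have /choice[pk Hpk] : forall i, exists pk : 'rV[R]_d * nat,
    (forall y, F i y -> forall j, `|y 0 j - pk.1 0 j| <= (n ^ pk.2)%:R^-1) /\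
    (((N ^ pk.2)%:R^-1)%:E <= N%:R%:E * diameter_pow euclidean_dist s (F i) +
       (e / (2 ^ i.+1)%:R)%:E)%E.
  move=> i; have ei : 0 < e / (2 ^ i.+1)%:R by rewrite divr_gt0 // ltr0n expn_gt0.
  by have [p [k H]] := cover_scale s0 (ltW nsN) ei (F1 i); exists (p, k).
pose k i := (pk i).2; pose p i := (pk i).1.
(* Doubling the radius makes the boxes open, so that compactness applies. *)
have [L EL] : exists L, forall y, E y ->
    exists2 i, (i < L)%N & ball (p i) (2 / (n ^ k i)%:R) y.
  move: cE; rewrite compact_cover => /(_ nat setT (fun i => ball (p i) (2 / (n ^ k i)%:R))).
  case=> [i _|y Ey|D' _ ED']; first exact: ball_open.
    have [i _ Fi] := EF y Ey; exists i => //.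
    rewrite -ball_normE /=; apply/rV_norm_lt; first by rewrite divr_gt0.
    move=> j; rewrite distrC; apply: le_lt_trans ((Hpk i).1 y Fi j) _.
    by rewrite -[X in X < _]mul1r ltr_pM2r ?invr_gt0 // ltr1n.
  exists (\max_(i <- finmap.enum_fset D') i).+1 => y /ED'[i /= iD' yi]; exists i => //.
  by rewrite ltnS; exact: (leq_bigmax_seq i).
pose K := \max_(i < L) k i.
have kK i : (i < L)%N -> (k i <= K)%N.
  by move=> iL; exact: (leq_bigmax (Ordinal iL)).
have count_le : (N ^ K <= \sum_(0 <= i < L) 6 ^ d * N ^ (K - k i))%N.
  rewrite -(size_words n).
  have : (size (words n G K) <=
      \sum_(0 <= i < L) count (box_meets (k i) (p i) (n ^ K)) (words n G K))%N.
    apply: size_le_sum_count => v vK.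
    have [y yv] := cell_nonempty frE v (nk_gt0 K).
    have [i iL yi] := EL y (words_cell_sub frE vK yv); exists i => //.
    apply/asboolP; exists y => // j; rewrite distrC.
    by move: yi; rewrite -ball_normE /= => /rV_norm_lt; apply; rewrite divr_gt0.
  move/leq_trans; apply; rewrite !big_nat; apply: leq_sum => i /andP[_ iL].
  by rewrite -{1 2}(subnKC (kK i iL)) count_box_meets.
have sum_ge : 1 <= B * \sum_(0 <= i < L) (N ^ k i)%:R^-1.
  rewrite -(ler_pM2r (N0 K)) mul1r.
  move: count_le; rewrite -(ler_nat R) => /le_trans; apply.
  rewrite natr_sum mulr_sumr mulr_suml !big_nat ler_sum // => i /andP[_ iL].
  rewrite natrM -mulrA ler_pM2l // -{2}(subnK (kK i iL)) expnD natrM.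
  by rewrite mulrCA mulVf ?mulr1 // gt_eqF.
have sum_lt : ((\sum_(0 <= i < L) ((N ^ k i)%:R^-1 : R))%:E <= (2 * e)%:E)%E.
  rewrite -sumEFin.
  have dp0 i : (0 <= diameter_pow euclidean_dist s (F i))%E.
    by rewrite /diameter_pow; case: ifP => // _; exact: poweR_ge0.
  have t0 i : (0 <= N%:R%:E * diameter_pow euclidean_dist s (F i))%E.
    by rewrite mule_ge0 // lee_fin ler0n.
  apply: (@le_trans _ _ (\sum_(0 <= i < L) (N%:R%:E * diameter_pow euclidean_dist s (F i) +
       (e / (2 ^ i.+1)%:R)%:E))%E).
    by apply: lee_sum => i _; exact: (Hpk i).2.
  apply: le_trans (nneseries_lim_ge _ _) _.
    by move=> i _ _; rewrite adde_ge0 // lee_fin divr_ge0 // ltW.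
  apply: le_trans (epsilon_trick _ t0 (ltW e0)) _.
  rewrite nneseriesZl // mulr2n mulrDl mul1r EFinD leeD2r //.
  rewrite -lee_pdivlMl // muleC; exact: ltW.
move: sum_lt; rewrite lee_fin => /(ler_wpM2l (ltW B0)) h.
have := le_trans sum_ge h; rewrite /e invfM.
rewrite (_ : B * (2 * (4^-1 * B^-1)) = 2^-1); last first.
  by field; rewrite gt_eqF.
lra.
Qed.

End lower_bound.

(** * Sets with few small covers *)

Section thin_sets.
Context {R : realType} {X : Type} (dist : X -> X -> R) (n m : nat).
Hypothesis n2 : (1 < n)%N.
Hypothesis dist_ge0 : forall a b, 0 <= dist a b.
Implicit Types (A B : set X).

(** A covering condition at every scale: it implies dimension at most $\log_n m$ for [m > 0], passes
    to finite unions, and forces emptiness for [m = 0]. One constant bounds both the number and the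
    size of the pieces. *)
Definition thin B := exists C : nat, forall p, exists s : seq (set X),
  [/\ (size s <= C * m ^ p)%N,
      forall y, B y -> exists2 q, (q < size s)%N & nth set0 s q y &
      forall q a b, (q < size s)%N -> nth set0 s q a -> nth set0 s q b ->
        dist a b <= C%:R / (n ^ p)%:R].

Let np0 p : 0 < (n ^ p)%:R :> R.
Proof. by rewrite ltr0n expn_gt0; lia. Qed.

Lemma thin_subset A B : A `<=` B -> thin B -> thin A.
Proof.
move=> AB [C H]; exists C => p; have [s [s1 s2 s3]] := H p; exists s; split => //.
by move=> y /AB; exact: s2.
Qed.

Lemma thinU A B : thin A -> thin B -> thin (A `|` B).
Proof.
move=> [C H] [C' H']; exists (C + C')%N => p.
have [s [s1 s2 s3]] := H p; have [s' [s1' s2' s3']] := H' p.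
exists (s ++ s'); split.
- by rewrite size_cat mulnDl leq_add.
- move=> y [/s2[q qs ys]|/s2'[q qs ys]].
    by exists q; [rewrite size_cat ltn_addr|rewrite nth_cat qs].
  exists (size s + q)%N; first by rewrite size_cat ltn_add2l.
  by rewrite nth_cat ltnNge leq_addr /= addKn.
- move=> q a b; rewrite size_cat nth_cat natrD mulrDl.
  case: (ltnP q (size s)) => qs qss' aq bq.
    by apply: le_trans (s3 q _ _ qs aq bq) _; rewrite lerDl divr_ge0 ?ler0n.
  have qs' : (q - size s < size s')%N by lia.
  by apply: le_trans (s3' _ _ _ qs' aq bq) _; rewrite lerDr divr_ge0 ?ler0n.
Qed.

Lemma thin0 : thin set0.
Proof. by exists 0%N => p; exists [::]; split => // y []. Qed.

Lemma thin_eq0 B : m = 0%N -> thin B -> B = set0.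
Proof.
(* Level 1 is used because [0 ^ 0 = 1]. *)
move=> m0 [C H]; rewrite -subset0 => y By; have [s [s1 s2 _]] := H 1%N.
by move: s1; rewrite m0 muln0 leqn0 => /eqP s0; have [q] := s2 y By; rewrite s0.
Qed.

Lemma thin_measure0 B (s : R) : 0 <= s -> m%:R < n%:R `^ s -> thin B ->
  hausdorff_measure dist s B = 0%E.
Proof.
move=> s0 ms [C H].
have pow_ge0 A : (0 <= diameter_pow dist s A)%E.
  by rewrite /diameter_pow; case: ifP => // _; exact: poweR_ge0.
apply/eqP; rewrite eq_le; apply/andP; split; last first.
  apply: (@le_trans _ _ (hausdorff_premeasure dist s 1 B)).
    apply: le_ereal_inf_tmp => _ [F _ <-]; exact: nneseries_ge0.
  by apply: ereal_sup_ubound; exists 1 => //=.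
apply: ge_ereal_sup => _ [delta /= delta0 <-].
apply/lee_addgt0Pr => e e0; rewrite add0e.
have ns0 : 0 < n%:R `^ s by rewrite powR_gt0 // ltr0n; lia.
pose z := m%:R / n%:R `^ s.
have z1 : `|z| < 1.
  by rewrite ger0_norm ?divr_ge0 ?ler0n ?powR_ge0 // ltr_pdivrMr // mul1r.
(* The cover at level $p$ costs at most $C m^p (C/n^p)^s = a z^p$, which tends to 0. *)
pose a : R := C%:R * C%:R `^ s.
have [p [pd pe]] : exists p, C%:R / (n ^ p)%:R <= delta /\ a * z ^+ p <= e.
  have h1 : \forall p \near \oo, a * z ^+ p < e.
    exact: (cvgr_lt 0 (cvg_geometric a z1)).
  have [k _ hk] := @pow_beats R n C%:R delta n2 delta0.
  near \oo => p; exists p; split.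
    rewrite ler_pdivrMr //; apply: le_trans (ltW hk) _.
    by rewrite ler_pM2l // ler_nat leq_exp2l //; near: p; exact: nbhs_infty_ge.
  by apply: ltW; near: p; exact: h1.
have [ss [s1 s2 s3]] := H p.
have diam_le q : (diameter dist (nth set0 ss q) <= (C%:R / (n ^ p)%:R)%:E)%E.
  apply: ge_ereal_sup => _ [[u v] [/= uq vq] <-]; rewrite lee_fin.
  have [qs|qs] := ltnP q (size ss); first exact: s3 uq vq.
  by move: uq; rewrite nth_default.
(* The finite list is padded with empty sets, which contribute 0 even for [s = 0]. *)
apply: (@le_trans _ _ (\sum_(0 <= i <oo) diameter_pow dist s (nth set0 ss i))%E).
  apply: ereal_inf_lbound; exists (nth set0 ss) => //; split.
    by move=> y /s2[q _ yq]; exists q.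
  by move=> q; apply: le_trans (diam_le q) _; rewrite lee_fin.
set c := ((C%:R / (n ^ p)%:R) `^ s).
have term q : (diameter_pow dist s (nth set0 ss q) <= if (q < size ss)%N then c%:E else 0)%E.
  have [qs|qs] := ltnP q (size ss); last by rewrite nth_default // /diameter_pow eqxx.
  rewrite /diameter_pow; case: ifP => [_|/negbT/set0P[y yq]].
    by rewrite lee_fin powR_ge0.
  have d0 : (0 <= diameter dist (nth set0 ss q))%E.
    apply: le_trans (_ : (dist y y)%:E <= _)%E; first by rewrite lee_fin.
    by apply: ereal_sup_ubound; exists (y, y).
  rewrite /c -poweR_EFin; apply: gt0_ler_poweR => //.
    by rewrite in_itv /= d0 leey.
  by rewrite in_itv /= leey andbT lee_fin divr_ge0 ?ler0n.
apply: lime_le; first exact: is_cvg_nneseries.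
near=> L.
apply: le_trans (lee_sum _ (fun q _ => term q)) _.
rewrite -big_mkcond /= -(big_nat_widen 0 (size ss) L xpredT) //=; last first.
  by near: L; exact: nbhs_infty_ge.
rewrite sumEFin sumr_const_nat subn0 lee_fin.
apply: le_trans pe; rewrite -mulr_natl.
apply: (@le_trans _ _ ((C * m ^ p)%:R * c)); first by rewrite ler_wpM2r ?powR_ge0 // ler_nat.
rewrite /c /a /z powRM ?ler0n ?invr_ge0 // natrM natrX expr_div_n.
rewrite -powR_inv1 ?ler0n // powRAC powR_inv1 ?powR_ge0 //.
rewrite natrX -(powR_mulrn p (ler0n R n)) powRAC powR_mulrn ?powR_ge0 //.
by rewrite mulrACA.
Unshelve. all: by end_near. Qed.

Lemma thin_dim B : (0 < m)%N -> thin B ->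
  (hausdorff_dim dist B <= (ln m%:R / ln n%:R)%:E)%E.
Proof.
move=> m0 tB; have n1 : 1 < n%:R :> R by rewrite ltr1n.
have lnn : 0 < ln n%:R :> R by exact: ln_gt0.
have t0 : 0 <= ln m%:R / ln n%:R :> R.
  by apply: divr_ge0; [apply: ln_ge0; rewrite ler1n|exact: ltW].
rewrite /hausdorff_dim; case: ifP => _.
  by rewrite lee_fin; apply: le_trans t0; rewrite lerN10.
apply/lee_addgt0Pr => e e0; rewrite -EFinD.
apply: ereal_inf_lbound; exists (ln m%:R / ln n%:R + e) => //; split.
  by rewrite addr_ge0 // ltW.
apply: thin_measure0 => //; first by rewrite addr_ge0 // ltW.
rewrite -ltr_ln ?posrE ?powR_gt0 ?ltr0n //; last by lia.
rewrite ln_powR mulrDl divfK ?gt_eqF //.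
by rewrite ltrDl mulr_gt0.
Qed.
End thin_sets.

(** * Cuts along hyperplanes *)

Lemma euclidean_dist_le {R : realType} {d : nat} (x y : 'rV[R]_d) c : 0 <= c ->
  (forall i, `|x 0 i - y 0 i| <= c) -> euclidean_dist x y <= d%:R * c.
Proof.
move=> c0 H; rewrite -[leRHS]ger0_norm ?mulr_ge0 ?ler0n // -sqrtr_sqr.
rewrite ler_sqrt ?sqr_ge0 //.
apply: (@le_trans _ _ (\sum_(i < d) c ^+ 2)).
  by apply: ler_sum => i _; rewrite -[leLHS]real_normK ?num_real // lerXn2r ?nnegrE.
rewrite sumr_const card_ord exprMn -[leLHS]mulr_natl ler_wpM2r ?sqr_ge0 // -natrX ler_nat.
by case: d {x y H} => // d; rewrite leq_pmulr.
Qed.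

Section cuts.
Context {R : realType} {d : nat}.
Variables (n : nat) (G : seq {ffun 'I_d -> nat}) (E : set 'rV[R]_d).
Hypothesis n2 : (1 < n)%N.
Hypothesis frE : fractal n G E.
Variables (J : pred 'I_d) (I : pred {ffun 'I_d -> nat}) (m : nat).
Hypothesis J_const : forall i, ~~ J i -> forall g h, g \in G -> h \in G -> g i = h i.
Hypothesis I_closed : forall g h, g \in G -> I g -> h \in G -> adjacent J g h -> I h.
Hypothesis I_off : forall g i, g \in G -> I g -> J i -> (0 < g i < n.-1)%N.
Implicit Types (x y : 'rV[R]_d) (u v w g : {ffun 'I_d -> nat}).

Let Gn : digits n G. Proof. by case: frE. Qed.
Let uG : uniq G. Proof. by case: frE. Qed.
Let n_gt0 : (0 < n)%N. Proof. by lia. Qed.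
Let nk0 k : 0 < (n ^ k)%:R :> R. Proof. by rewrite ltr0n expn_gt0 n_gt0. Qed.

Lemma cells_adjacent M v w y i : cell E M v y -> cell E M w y -> (v i <= (w i).+1)%N.
Proof.
move=> yv yw; rewrite -(ler_nat R) -natr1.
have /andP[h1 _] := cell_coord n2 frE i yv.
by have /andP[_ h2] := cell_coord n2 frE i yw; exact: le_trans h2.
Qed.

Lemma wordsSP k v : v \in words n G k.+1 ->
  exists u g, [/\ u \in words n G k, g \in G & v = vec_app n u g].
Proof. by move=> /allpairsP[[u g] /= [uk Gg ->]]; exists u, g. Qed.

Lemma cell_parent_word k u g y : g \in G -> cell E (n ^ k.+1) (vec_app n u g) y ->
  cell E (n ^ k) u y.
Proof. by rewrite expnSr; exact: cell_parent. Qed.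

(** In the directions of [J], [g] avoids the digits 0 and [n - 1], so a cell touching that of [u g]
    has the same parent [u]; its last digit is then adjacent to [g]. *)
Lemma island_isolated k u g v y : u \in words n G k -> g \in G -> I g ->
  v \in words n G k.+1 ->
  cell E (n ^ k.+1) (vec_app n u g) y -> cell E (n ^ k.+1) v y ->
  exists h, [/\ h \in G, I h & v = vec_app n u h].
Proof.
move=> uk Gg Ig /wordsSP[u' [h [u'k Gh ->]]] yg yh.
have nb i : J i -> [/\ u i = u' i, (g i <= (h i).+1)%N & (h i <= (g i).+1)%N].
  move=> Ji; have := cells_adjacent i yg yh; have := cells_adjacent i yh yg.
  rewrite !ffunE => h2 h1; have /andP[g0 g1] := I_off Gg Ig Ji.
  by case: (near_blocks (Gn Gg i) (Gn Gh i) h1 h2) => [//|[_ e _]|[_ e _]];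
    move: g0 g1; rewrite e ?ltnn.
have e : u' = u.
  apply/ffunP => i; have [Ji|Ji] := boolP (J i); first by case: (nb i Ji).
  exact: (words_const (J_const Ji) u'k uk).
exists h; split => //; last by rewrite e.
by apply: (I_closed Gg) => // i Ji; case: (nb i Ji).
Qed.

Section one_cut.
Variables (i : 'I_d) (j k a : nat).
Hypothesis jn : (j < n)%N.

Let quo v : {ffun 'I_d -> nat} := [ffun l => v l %/ n]%N.
Let rem v : {ffun 'I_d -> nat} := [ffun l => v l %% n]%N.

(* The cut follows the hyperplane of digits [a j j j ...] in direction [i], but
   every island met on the way is put on the left side as a whole. *)
Fixpoint middle p v : bool :=
  if p is p'.+1 then [&& middle p' (quo v), ~~ I (rem v) & rem v i == j]
  else v i == a.

Fixpoint left_side p v : bool :=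
  if p is p'.+1 then
    left_side p' (quo v) || middle p' (quo v) && (I (rem v) || (rem v i < j)%N)
  else (v i < a)%N.

Fixpoint right_side p v : bool :=
  if p is p'.+1 then
    right_side p' (quo v) || [&& middle p' (quo v), ~~ I (rem v) & (j < rem v i)%N]
  else (a < v i)%N.

Fixpoint cut_pos p := if p is p'.+1 then (cut_pos p' * n + j)%N else a.

Let quo_app u g : g \in G -> quo (vec_app n u g) = u.
Proof.
by move=> Gg; apply/ffunP => l; rewrite !ffunE divnMDl // divn_small ?addn0 // Gn.
Qed.

Let rem_app u g : g \in G -> rem (vec_app n u g) = g.
Proof. by move=> Gg; apply/ffunP => l; rewrite !ffunE modnMDl modn_small // Gn. Qed.

Lemma cut_partition p v : (left_side p v + middle p v + right_side p v = 1)%N.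
Proof.
elim: p v => [|p IH] v /=; first by case: ltngtP.
have := IH (quo v); case: left_side; case: middle; case: right_side => //= _.
by case: (I _) => //=; case: ltngtP.
Qed.

Lemma middle_pos p v : middle p v -> v i = cut_pos p.
Proof.
elim: p v => [|p IH] v /=; first by move/eqP.
move=> /and3P[/IH + _ /eqP]; rewrite !ffunE => <- <-; exact: divn_eq.
Qed.

Lemma right_side_pos p v : right_side p v -> (cut_pos p < v i)%N.
Proof.
elim: p v => [|p IH] v //= /orP[/IH|/and3P[/middle_pos + _]]; rewrite !ffunE => h.
  rewrite [X in (_ < X)%N](divn_eq _ n).
  by have := leq_mul h (leqnn n); rewrite mulSn; lia.
by rewrite -h [X in (_ -> _ < X)%N](divn_eq _ n) ltn_add2l.
Qed.

(** A left word can lie beyond the hyperplane only if an ancestor was moved along with an island.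
    Cells touching it then descend from the same copy of the island, so they are left as well. *)
Lemma left_side_pos p v : v \in words n G (k + p) -> left_side p v ->
  (v i < cut_pos p)%N \/ forall v' y, v' \in words n G (k + p) ->
    cell E (n ^ (k + p)) v y -> cell E (n ^ (k + p)) v' y -> left_side p v'.
Proof.
elim: p v => [|p IH] v; first by move=> _ /= h; left.
rewrite addnS => /wordsSP[u [g [uk Gg ->]]] /=; rewrite quo_app // rem_app //.
move=> /orP[lu|/andP[mu]].
  have [h|iso] := IH u uk lu.
    by left; rewrite ffunE; have := leq_mul h (leqnn n); have := Gn Gg i; rewrite mulSn; lia.
  right=> v' y /wordsSP[u' [g' [uk' Gg' ->]]] yv yv' /=; rewrite quo_app // rem_app //.
  by rewrite (iso u' y) //; [exact: cell_parent_word yv|exact: cell_parent_word yv'].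
have [Ig _|_ /= gj] := boolP (I g).
  right=> v' y v'k yv yv'; have [h [Gh Ih ->]] := island_isolated uk Gg Ig v'k yv yv'.
  by rewrite /= quo_app // rem_app // mu Ih orbT.
by left; rewrite ffunE (middle_pos mu) ltn_add2l.
Qed.

Let not_right p := \bigcup_(v in [set` [seq v <- words n G (k + p) | ~~ right_side p v]])
  cell E (n ^ (k + p)) v.
Let not_left p := \bigcup_(v in [set` [seq v <- words n G (k + p) | ~~ left_side p v]])
  cell E (n ^ (k + p)) v.

(** The two closed sides of the cut: points that at every level have a cell not assigned to the
    other side. *)
Let cutA := \bigcap_p not_right p.
Let cutB := \bigcap_p not_left p.

Lemma cutA_closed : closed cutA.
Proof.
apply: closed_bigI => p _; apply: closed_bigcup; first exact: finite_seq.
by move=> v _; exact: cell_closed frE _ _.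
Qed.

Lemma cutB_closed : closed cutB.
Proof.
apply: closed_bigI => p _; apply: closed_bigcup; first exact: finite_seq.
by move=> v _; exact: cell_closed frE _ _.
Qed.

(** A point may lie in several cells; a property inherited by children and true of all its cells at
    one level remains true of all its deeper cells. *)
Let persistent (P : nat -> pred {ffun 'I_d -> nat}) y p r :
  (forall p u g, g \in G -> P p u -> P p.+1 (vec_app n u g)) ->
  (forall v, v \in words n G (k + p) -> cell E (n ^ (k + p)) v y -> P p v) ->
  forall v, v \in words n G (k + (p + r)) -> cell E (n ^ (k + (p + r))) v y -> P (p + r)%N v.
Proof.
move=> PS; elim: r => [|r IH] H v; first by rewrite addn0; exact: H.
rewrite !addnS => /wordsSP[u [g [uk Gg ->]]] yv; apply: PS => //.
by apply: IH => //; exact: cell_parent_word yv.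
Qed.

(** A point outside both sides has only right cells at some level [p] and only left cells at some
    level [q], hence cells that are both at level [p + q]. *)
Lemma cut_cover : E `<=` cutA `|` cutB.
Proof.
move=> y Ey; apply: contrapT => /not_orP[].
move=> /existsNP[p /not_implyP[_ nA]] /existsNP[q /not_implyP[_ nB]].
have Rp v : v \in words n G (k + p) -> cell E (n ^ (k + p)) v y -> right_side p v.
  move=> vk yv; apply/negPn/negP => nr; apply: nA; exists v => //=.
  by rewrite mem_filter nr.
have Lq v : v \in words n G (k + q) -> cell E (n ^ (k + q)) v y -> left_side q v.
  move=> vk yv; apply/negPn/negP => nl; apply: nB; exists v => //=.
  by rewrite mem_filter nl.
have Rs p' u g : g \in G -> right_side p' u -> right_side p'.+1 (vec_app n u g).
  by move=> Gg ru /=; rewrite quo_app // ru.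
have Ls p' u g : g \in G -> left_side p' u -> left_side p'.+1 (vec_app n u g).
  by move=> Gg lu /=; rewrite quo_app // lu.
have /(fractal_words frE (k + (p + q)))[v vk yv] := Ey.
have := cut_partition (p + q) v.
rewrite (persistent Rs Rp vk yv) addnC.
have vk' := vk; have yv' := yv; rewrite (addnC p q) in vk' yv'.
by have := persistent Ls Lq vk' yv'; rewrite addnC => ->; lia.
Qed.

Lemma cutA_le y : cutA y -> (n ^ k)%:R * y 0 i <= a%:R + 1.
Proof.
move=> /(_ 0%N Logic.I)[v /=]; rewrite mem_filter /= -leqNgt addn0 => /andP[va _] yv.
have /andP[_ h] := cell_coord n2 frE i yv; apply: le_trans h _.
by rewrite lerD2r ler_nat.
Qed.

Lemma cutB_ge y : cutB y -> a%:R <= (n ^ k)%:R * y 0 i.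
Proof.
move=> /(_ 0%N Logic.I)[v /=]; rewrite mem_filter /= -leqNgt addn0 => /andP[va _] yv.
have /andP[h _] := cell_coord n2 frE i yv; apply: le_trans h.
by rewrite ler_nat.
Qed.

(** Otherwise a left cell and a right cell share [y]. Either their positions lie strictly on both
    sides of [cut_pos p], so differ by at least two, or the left one only touches left cells. *)
Lemma cutAB_middle y p : cutA y -> cutB y ->
  exists2 v, v \in [seq v <- words n G (k + p) | middle p v] & cell E (n ^ (k + p)) v y.
Proof.
move=> /(_ p Logic.I)[v /= + yv] /(_ p Logic.I)[w /= + yw].
rewrite !mem_filter => /andP[nr vk] /andP[nl wk].
have [mv|nmv] := boolP (middle p v); first by exists v; rewrite ?mem_filter ?mv.
have [mw|nmw] := boolP (middle p w); first by exists w; rewrite ?mem_filter ?mw.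
have lv : left_side p v.
  by have := cut_partition p v; rewrite (negPf nr) (negPf nmv); case: left_side.
have rw : right_side p w.
  by have := cut_partition p w; rewrite (negPf nl) (negPf nmw); case: right_side.
have [h|iso] := left_side_pos vk lv; last by rewrite (iso w y) in nl.
have := cells_adjacent i yw yv; have := right_side_pos rw; lia.
Qed.

Hypothesis count_j : (count (fun g => ~~ I g && (g i == j)) G <= m)%N.

Lemma count_middle p : (count (middle p) (words n G (k + p)) <= size G ^ k * m ^ p)%N.
Proof.
elim: p => [|p IH]; first by rewrite addn0 muln1 -(size_words n) count_size.
pose A := [seq u <- words n G (k + p) | middle p u].
pose B := [seq g <- G | ~~ I g && (g i == j)].
apply: (@leq_trans (size [seq vec_app n u g | u <- A, g <- B])); last first.
  by rewrite size_allpairs !size_filter expnSr mulnA leq_mul.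
rewrite -size_filter; apply: uniq_leq_size; first by rewrite filter_uniq // words_uniq.
move=> v; rewrite mem_filter addnS => /andP[/= + /wordsSP[u [g [uk Gg ev]]]].
rewrite ev quo_app // rem_app // => /and3P[mu nI gj].
by apply/allpairsP; exists (u, g); split; rewrite //= mem_filter ?mu ?nI ?gj.
Qed.

Lemma cut_thin : thin (fun x y : E => euclidean_dist (set_val x) (set_val y)) n m
  (set_val @^-1` (cutA `&` cutB)).
Proof.
(* The first summand bounds the number of pieces, the second the diameter of a cube of side
   $n^{-p}$. *)
exists (size G ^ k + d)%N => p.
exists [seq (set_val @^-1` cell E (n ^ (k + p)) v : set E)
       | v <- [seq v <- words n G (k + p) | middle p v]]; split.
- rewrite size_map size_filter mulnDl; apply: leq_trans (count_middle p) _.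
  exact: leq_addr.
- move=> y [yA yB]; have [v vm yv] := cutAB_middle p yA yB.
  exists (index v [seq v <- words n G (k + p) | middle p v]).
    by rewrite size_map index_mem.
  by rewrite (nth_map v) ?index_mem // nth_index.
- move=> q x y; rewrite size_map => qs.
  rewrite !(nth_map [ffun=> 0%N]) //; set v := nth _ _ _ => xv yv.
  apply: (@le_trans _ _ (d%:R * (n ^ p)%:R^-1)); last first.
    by rewrite ler_wpM2r ?invr_ge0 ?ler0n // ler_nat leq_addl.
  apply: euclidean_dist_le => [|l]; first by rewrite invr_ge0 ler0n.
  have /andP[x1 x2] := cell_coord n2 frE l xv; have /andP[y1 y2] := cell_coord n2 frE l yv.
  apply: (@le_trans _ _ (n ^ (k + p))%:R^-1).
    rewrite -[leRHS]div1r ler_pdivlMr // -[X in _ * X]gtr0_norm // -normrM mulrC mulrBr.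
    by rewrite ler_norml; apply/andP; split; lra.
  by rewrite lef_pV2 ?posrE // ler_nat leq_exp2l // leq_addl.
Qed.

Lemma cut_exists : exists A B : set 'rV[R]_d,
  [/\ closed A, closed B, E `<=` A `|` B,
      (forall y, A y -> (n ^ k)%:R * y 0 i <= a%:R + 1) /\
      (forall y, B y -> a%:R <= (n ^ k)%:R * y 0 i) &
      thin (fun x y : E => euclidean_dist (set_val x) (set_val y)) n m
        (set_val @^-1` (A `&` B))].
Proof.
exists cutA, cutB; split; [exact: cutA_closed|exact: cutB_closed|exact: cut_cover| |].
  by split=> y; [exact: cutA_le|exact: cutB_ge].
exact: cut_thin.
Qed.

End one_cut.
End cuts.

(** * A basis with thin boundaries *)

Section boundaries.
Context {X : topologicalType}.
Implicit Types U V : set X.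

Lemma boundaryI U V : open U -> open V ->
  boundary (U `&` V) `<=` boundary U `|` boundary V.
Proof.
move=> oU oV y [clUV]; have oUV := openI oU oV; have [clU clV] := closureI clUV.
rewrite /boundary ((interior_id _).1 oU) ((interior_id _).1 oV) ((interior_id _).1 oUV).
by move=> /not_andP[nU|nV]; [left|right].
Qed.

Lemma boundaryT : boundary [set: X] = set0.
Proof. by rewrite /boundary interiorT setDT. Qed.

Lemma boundary_closedC (A B : set X) : closed A -> closed B -> A `|` B = setT ->
  boundary (~` B) `<=` A `&` B.
Proof.
move=> cA cB AB y [clB]; rewrite ((interior_id _).1 (closed_openC cB)).
move=> /contrapT By; split => //; apply: cA; apply: closureS clB.
move=> z nBz; have : (A `|` B) z by rewrite AB.
by case.
Qed.

End boundaries.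

Section fine_basis.
Context {R : realType} {d : nat}.
Variables (n : nat) (G : seq {ffun 'I_d -> nat}) (E : set 'rV[R]_d).
Hypothesis n2 : (1 < n)%N.
Hypothesis frE : fractal n G E.
Variables (J : pred 'I_d) (I : pred {ffun 'I_d -> nat}) (m : nat).
Hypothesis J_const : forall i, ~~ J i -> forall g h, g \in G -> h \in G -> g i = h i.
Hypothesis I_closed : forall g h, g \in G -> I g -> h \in G -> adjacent J g h -> I h.
Hypothesis I_off : forall g i, g \in G -> I g -> J i -> (0 < g i < n.-1)%N.
Hypothesis count_ex : forall i, exists2 j, (j < n)%N &
  (count (fun g => ~~ I g && (g i == j)) G <= m)%N.

Let dist (x y : E) := euclidean_dist (set_val x) (set_val y).

Definition thin_open : set (set E) := [set U | open U /\ thin dist n m (boundary U)].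

Lemma thin_openT : thin_open setT.
Proof. by split; [exact: openT|rewrite boundaryT; exact: thin0]. Qed.

Lemma thin_openI U V : thin_open U -> thin_open V -> thin_open (U `&` V).
Proof.
move=> [oU tU] [oV tV]; split; first exact: openI.
apply: (thin_subset (boundaryI oU oV)).
by apply: thinU => //; rewrite /dist => *.
Qed.

Let set_val_closed (A : set 'rV[R]_d) : closed A -> closed (set_val @^-1` A : set E).
Proof.
have /continuous_closedP := @initial_continuous E 'rV[R]_d set_val.
by move=> H cA; exact: H.
Qed.

Let nk0 k : 0 < (n ^ k)%:R :> R. Proof. by rewrite ltr0n expn_gt0; lia. Qed.

Lemma thin_open_slab (x : E) k i : exists U, [/\ thin_open U, U x &
  forall y, U y -> `|set_val y 0 i - set_val x 0 i| <= 3 / (n ^ k)%:R].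
Proof.
have Ey (y : E) : E (set_val y) by exact: set_valP.
have /(fractal_words frE k)[w wk xw] := Ey x.
have /andP[x1 x2] := cell_coord n2 frE i xw.
have norm_le (y : E) : (w i)%:R - 2 <= (n ^ k)%:R * set_val y 0 i ->
    (n ^ k)%:R * set_val y 0 i <= (w i)%:R + 3 ->
    `|set_val y 0 i - set_val x 0 i| <= 3 / (n ^ k)%:R.
  move=> y1 y2; rewrite ler_pdivlMr // -[X in _ * X]gtr0_norm // -normrM mulrC mulrBr.
  by rewrite ler_norml; apply/andP; split; lra.
have [Ji|Ji] := boolP (J i); last first.
  exists setT; split => //; first exact: thin_openT.
  move=> y _; have /(fractal_words frE k)[v vk yv] := Ey y.
  have /andP[y1 y2] := cell_coord n2 frE i yv.
  rewrite (words_const (J_const Ji) vk wk) in y1 y2.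
  by apply: norm_le; lra.
have [j jn cj] := count_ex i.
have cutTop (A B : set 'rV[R]_d) : E `<=` A `|` B ->
    (set_val @^-1` A : set E) `|` set_val @^-1` B = setT.
  by move=> EAB; rewrite -subTset => y _; exact: EAB.
(* The cell of [x] spans $[w_i, w_i+1]$ in units of $n^{-k}$. Cuts at $w_i+2$ and $w_i-2$, each of
   width one, stay clear of it and leave at most 3 units on either side. *)
have [A [B [cA cB EAB [Ale Bge] tAB]]] :=
  cut_exists n2 frE J_const I_closed I_off k (w i + 2) jn cj.
have [U [tU Ux Ule]] : exists U, [/\ thin_open U, U x &
    forall y, U y -> (n ^ k)%:R * set_val y 0 i <= (w i)%:R + 3].
  exists (~` (set_val @^-1` B)); split.
  - split; first by apply: closed_openC; exact: set_val_closed.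
    apply: thin_subset tAB.
    by apply: boundary_closedC; [exact: set_val_closed|exact: set_val_closed|exact: cutTop].
  - by move=> /Bge; rewrite natrD => ?; lra.
  - by move=> y nBy; have [/Ale|//] := EAB _ (Ey y); rewrite natrD; lra.
have [V [tV Vx Vge]] : exists V, [/\ thin_open V, V x &
    forall y, V y -> (w i)%:R - 2 <= (n ^ k)%:R * set_val y 0 i].
  (* If $w_i < 2$, the lower bound is negative and needs no cut. *)
  have [wi|wi] := ltnP (w i) 2.
    exists setT; split => //; first exact: thin_openT.
    move=> y _; have /andP[y0 _] := fractal_unit n2 frE i (Ey y).
    apply: (@le_trans _ _ 0); last by rewrite mulr_ge0 // ltW.
    by rewrite subr_le0 ler_nat ltnW.
  have [A' [B' [cA' cB' EAB' [Ale' Bge'] tAB']]] :=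
    cut_exists n2 frE J_const I_closed I_off k (w i - 2) jn cj.
  rewrite natrB // in Ale' Bge'.
  exists (~` (set_val @^-1` A')); split.
  - split; first by apply: closed_openC; exact: set_val_closed.
    apply: thin_subset tAB'; rewrite preimage_setI setIC.
    apply: boundary_closedC; [exact: set_val_closed|exact: set_val_closed|].
    by rewrite setUC; exact: cutTop.
  - by move=> /Ale' ?; lra.
  - by move=> y nAy; have [//|/Bge'] := EAB' _ (Ey y).
exists (U `&` V); split; first exact: thin_openI.
- by [].
- by move=> y [Uy Vy]; apply: norm_le; [exact: Vge|exact: Ule].
Qed.

Lemma thin_open_box (x : E) k (r : seq 'I_d) : exists U, [/\ thin_open U, U x &
  forall y i, i \in r -> U y -> `|set_val y 0 i - set_val x 0 i| <= 3 / (n ^ k)%:R].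
Proof.
elim: r => [|i r [U [tU Ux HU]]]; first by exists setT; split => //; exact: thin_openT.
have [V [tV Vx HV]] := thin_open_slab x k i.
exists (V `&` U); split; [exact: thin_openI|by []|].
by move=> y l; rewrite inE => /orP[/eqP ->|lr] [Vy Uy]; [exact: HV|exact: HU].
Qed.

Lemma thin_open_basis : basis thin_open.
Proof.
split; first by move=> U [].
move=> x V; rewrite /nbhs /= => -[_ /= [[W oW <-] /= Wx WV]].
have /nbhs_ballP[e /= e0 eW] : nbhs (set_val x) W by exact: open_nbhs_nbhs.
have [k _ hk] := @pow_beats R n 3 e n2 e0.
have [U [tU Ux HU]] := thin_open_box x k (enum 'I_d).
exists U => // y Uy; apply: WV; apply: eW; rewrite -ball_normE /=.
apply/rV_norm_lt => // i; rewrite distrC.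
apply: le_lt_trans (HU y i _ Uy) _; first by rewrite mem_enum.
by rewrite ltr_pdivrMr.
Qed.

(** For [m = 0] the boundaries are empty, of dimension -1, so the bound is 0; otherwise it is $1 +
    \log_n m = \log_n (nm)$. *)
Lemma dim_tH_le :
  (dim_tH E <= if (m == 0)%N then 0%:E else (ln (n * m)%:R / ln n%:R)%:E)%E.
Proof.
have [[z Ez] _ _ _ _] := frE.
have dist0 x y : 0 <= dist x y by exact: sqrtr_ge0.
rewrite /dim_tH /topological_hausdorff_dim ifF; last first.
  apply/negP => /eqP /seteqP[/(_ (exist _ z (mem_set Ez)) Logic.I)]; exact.
apply: (@le_trans _ _
  (1%:E + ereal_sup [set hausdorff_dim dist (boundary U) | U in thin_open])%E).
  by apply: ereal_inf_lbound; exists thin_open => //; exact: thin_open_basis.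
have [m0|m0] := posnP m.
  apply: (@le_trans _ _ (1%:E + (-1)%:E)%E); last by rewrite -EFinD subrr.
  rewrite leeD2l //; apply: ge_ereal_sup => _ [U [_ tU] <-].
  by rewrite /hausdorff_dim (thin_eq0 m0 tU) eqxx.
apply: (@le_trans _ _ (1%:E + (ln m%:R / ln n%:R)%:E)%E).
  by rewrite leeD2l //; apply: ge_ereal_sup => _ [U [_ tU] <-]; exact: thin_dim.
have lnn : 0 < ln n%:R :> R by apply: ln_gt0; rewrite ltr1n.
rewrite -EFinD lee_fin natrM lnM ?posrE ?ltr0n //; last by lia.
by rewrite mulrDl divff // gt_eqF.
Qed.

Lemma dim_H_ge : (1 < size G)%N -> ((ln (size G)%:R / ln n%:R)%:E <= dim_H E)%E.
Proof.
move=> N2; have [E0 _ _ _ _] := frE.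
rewrite /dim_H /hausdorff_dim ifF; last by apply/negbTE/set0P.
apply: le_ereal_inf_tmp => _ [s [s0 Hs] <-]; rewrite lee_fin.
have lnn : 0 < ln n%:R :> R by apply: ln_gt0; rewrite ltr1n.
rewrite ler_pdivrMr // -ln_powR ler_ln ?posrE ?powR_gt0 ?ltr0n //; try lia.
exact: (fractal_dim_ge n2 frE).
Qed.

End fine_basis.

(** * Choice of the cutting digit and conclusion *)

(** Pigeonhole: the [n] values of coordinate [i] partition the digits outside [I], so some class has
    at most the average size. *)
Lemma count_digit_le (d n : nat) (G : seq {ffun 'I_d -> nat}) (I : pred {ffun 'I_d -> nat}) i :
  (0 < n)%N -> digits n G -> exists2 j, (j < n)%N &
  (count (fun g => ~~ I g && (g i == j)) G <= count (predC I) G %/ n)%N.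
Proof.
move=> n0 Gn; apply: contrapT => H.
have big j : (j < n)%N ->
    ((count (predC I) G %/ n).+1 <= count (fun g => ~~ I g && (g i == j)) G)%N.
  by move=> jn; rewrite ltnNge; apply/negP => le; apply: H; exists j.
have sumE : (\sum_(j < n) count (fun g => ~~ I g && (g i == j)) G = count (predC I) G)%N.
  elim: G Gn {H big} => [|g G IH] Gn; first by rewrite /= big1.
  rewrite /= big_split /= IH; last by move=> h Gh; apply: Gn; rewrite inE Gh orbT.
  congr addn; rewrite (bigD1 (Ordinal (Gn g (mem_head _ _) i))) //= eqxx andbT big1 ?addn0 //.
  move=> j /negPf jg; rewrite andbC; case: eqP => // e.
  by move: jg; rewrite -val_eqE /= e eqxx.
have : (\sum_(j < n) (count (predC I) G %/ n).+1 <= count (predC I) G)%N.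
  by rewrite -[X in (_ <= X)%N]sumE; apply: leq_sum => j _; exact: big.
by rewrite sum_nat_const card_ord mulnC leqNgt ltn_ceil.
Qed.

Theorem corollary1p1 (R : realType) (d n : nat) (D : {set 'rV['I_n]_d})
    (E : set 'rV[R]_d) (hn : (2 <= n)%N) (hD : (2 <= #|D|)%N)
    (hE : is_fractal_cube D E) (hdim : dim_H E = dim_tH E) :
  ~ (exists x : 'rV[R]_d, trivial_point E x).
Proof.
move=> [x xE].
have [G0 fr0 sG0] := fractal_of_cube (ltnW hn) hE.
have [_ _ G0n _ _] := fr0.
pose J : pred 'I_d := fun i => `[< exists g h, [/\ g \in G0, h \in G0 & g i <> h i] >].
have J_vary i : J i -> exists g h, [/\ g \in G0, h \in G0 & g i <> h i] by move/asboolP.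
have J_const i : ~~ J i -> forall g h, g \in G0 -> h \in G0 -> g i = h i.
  move=> /asboolP nJ g h Gg Gh; apply: contrapT => gh; apply: nJ.
  by exists g, h.
have [k0 [S0 [k00 isl0 opp0]]] := trivial_island hn fr0 J_const xE.
have [k [S [k0k [[v Sv] SG Scl] off]]] := interior_island hn G0n J_const J_vary isl0 opp0.
(* From here on the base is [M], the digits are the words of length [k], and the island is a set of
   digits. *)
have fr := fractal_power fr0 k; set M := (n ^ k)%N in fr off.
have kp : (0 < k)%N by exact: leq_trans k0k.
have M2 : (1 < M)%N by rewrite -[1%N](exp1n k) ltn_exp2r.
set G := words n G0 k in fr SG Scl.
have [_ _ Gn _ _] := fr.
pose I : pred {ffun 'I_d -> nat} := fun g => `[< S g >].
have N2 : (1 < size G)%N by rewrite size_words -[1%N](exp1n k) ltn_exp2r // sG0.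
pose m := (count (predC I) G %/ M)%N.
have Jc i : ~~ J i -> forall g h, g \in G -> h \in G -> g i = h i.
  by move=> Ji g h; exact: words_const (J_const _ Ji).
have Icl g h : g \in G -> I g -> h \in G -> adjacent J g h -> I h.
  by move=> _ /asboolP Sg Gh adj; apply/asboolP; exact: Scl adj.
have Ioff g i : g \in G -> I g -> J i -> (0 < g i < M.-1)%N.
  by move=> _ /asboolP Sg Ji; exact: off.
have up := dim_tH_le M2 fr Jc Icl Ioff (fun i => count_digit_le I i (ltnW M2) Gn).
have lo := dim_H_ge M2 fr N2.
have lnM : 0 < ln M%:R :> R by apply: ln_gt0; rewrite ltr1n.
(* The island is nonempty; this is the source of the strict inequality $Mm < N$. *)
have cI : (count (predC I) G < size G)%N.
  rewrite -(count_predC I G) -[X in (X < _)%N]add0n ltn_add2r -has_count.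
  by apply/hasP; exists v; [exact: SG|exact/asboolP].
have Mm : (M * m < size G)%N by apply: leq_ltn_trans cI; rewrite mulnC leq_trunc_div.
move: lo; rewrite hdim => /le_trans/(_ up); rewrite -/m.
(* If [m = 0] the upper bound is 0, while at least two digits make the lower bound positive.
   Otherwise the bounds compare the logarithms of $N$ and $Mm$. *)
have [_|m0] := posnP m; rewrite lee_fin.
  by rewrite leNgt divr_gt0 // ln_gt0 // ltr1n.
have Mm0 : (0 < M * m)%N by rewrite muln_gt0 m0 (ltnW M2).
by rewrite ler_pM2r ?invr_gt0 // ler_ln ?posrE ?ltr0n ?(ltn_trans Mm0 Mm) // ler_nat leqNgt Mm.
Qed.
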